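(* Let a Problem $\partial NP\mathcal{P}_\infty$ with data $x_1,\dots,x_n$, $w_1,\dots,w_n$, $v_1,\dots,v_n$ have Pick matrix $M$, and suppose that $n>1$ and $v_1>0$. If $f$ is a solution of this problem then the reduction $g$ of $f$ at $x_1$ is a solution of the Problem $\partial NP\mathcal{P}_\infty$ with data $$x_2,\dots,x_n,\qquad w_2',\dots,w_n'\in\mathbb{R}\cup\{\infty\},\qquad v_2',\dots,v_n'\ge 0$$ and Pick matrix $\tilde M$ satisfying $$\Lambda\tilde M\Lambda=\operatorname{schur} M,$$ where $\Lambda=\operatorname{diag}\{\lambda_2,\dots,\lambda_n\}$ and $$\lambda_j=\begin{cases} w_1-w_j & \text{if } w_1,w_j\in\mathbb{R} \text{ and } w_1\ne w_j\\ 1 & \text{otherwise.}\end{cases}$$ The data $w_j',v_j'$ are given explicitly by $$w_j'=\begin{cases}-\frac{1}{w_j-w_1}+\frac{1}{v_1(x_j-x_1)} & \text{if } w_j\neq w_1 \text{ in } \mathbb{R}\\ \frac{1}{v_1(x_j-x_1)} & \text{if } w_1\in\mathbb{R},\ w_j=\infty\\ w_j+\frac{1}{v_1(x_j-x_1)} & \text{if } w_1=\infty,\ w_j\in\mathbb{R}\\ \infty & \text{if } w_j=w_1,\end{cases}$$ $$v_j'=\begin{cases}\frac{v_j}{(w_j-w_1)^2}-\frac{1}{v_1(x_j-x_1)^2} & \text{if } w_j\ne w_1 \text{ in } \mathbb{R}\\ v_j-\frac{1}{v_1(x_j-x_1)^2} & \text{if } w_1\in\mathbb{R},\ w_j=\infty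 \text{ or } w_1=\infty,\ w_j\in\mathbb{R}\\ v_j & \text{if } w_j=w_1.\end{cases}$$
   Context: $\Pi=\{z\in\mathbb{C}:\operatorname{Im} z>0\}$. The Pick class $\mathcal{P}$ is the set of functions analytic and with non-negative imaginary part in $\Pi$. A function $f\in\mathcal{P}$ is analytic (meromorphic) at $x\in\mathbb{R}$ if it extends analytically (meromorphically) to a neighbourhood of $x$ in $\mathbb{C}$. Problem $\partial NP\mathcal{P}_\infty$: given distinct $x_1,\dots,x_n\in\mathbb{R}$, $w_1,\dots,w_n\in\mathbb{R}\cup\{\infty\}$ and $v_1,\dots,v_n\ge0$ with $v_j>0$ whenever $w_j=\infty$, determine whether there is a function $f\in\mathcal{P}$, meromorphic at $x_1,\dots,x_n$, such that for each $j$: (1) $f(x_j)=w_j$ and $f'(x_j)=v_j$ if $w_j\ne\infty$; (2) $f$ has a simple pole at $x_j$ of residue $-1/v_j$ if $w_j=\infty$. Such an $f$ is called a solution. The Pick matrix of the data is $M=[m_{ij}]_{i,j=1}^n$, where $m_{ii}=v_i$ and, for $i\neq j$, $$m_{ij}=\begin{cases}\frac{w_i-w_j}{x_i-x_j} & w_i,w_j\in\mathbb{R}\\ \frac{1}{x_i-x_j} & w_i=\infty,\ w_j\in\mathbb{R}\\ \frac{1}{x_j-x_i} & w_i\in\mathbb{R},\ w_j=\infty\\ 0 & w_i=w_j=\infty.\end{cases}$$ Reduction: for non-constant $f\in\mathcal{P}$ analytic at $x\in\mathbb{R}$ with $f(x)\in\mathbb{R}$, the reduction of $f$ at $x$ is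 the function $g$ on $\Pi$ with $g(z)=-\frac{1}{f(z)-f(x)}+\frac{1}{f'(x)(z-x)}$. For $f\in\mathcal{P}$ with a pole at $x$ of residue $R$, the reduction of $f$ at $x$ is $g(z)=f(z)-\frac{R}{z-x}$. $\operatorname{schur} M$ denotes the Schur complement of the $(1,1)$ entry: writing $M=\begin{bmatrix}A&B\\C&D\end{bmatrix}$ with $A=[m_{11}]$ the $1\times1$ block, $\operatorname{schur}M=D-CA^{-1}B$; its rows and columns, like those of $\tilde M$, are indexed by $2,\dots,n$.
   Formalization: When w_1 is real and w_j = ∞, λ_j is −1 instead of the printed 1; as printed the identity ΛM̃Λ = schur M fails in sign, e.g. for f(z) = z − 1/(z−1) at nodes 0, −1, 1. *)

(* Defs.v *)
From HB Require Import structures.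
From mathcomp Require Import all_boot all_order all_algebra.
From mathcomp Require Import complex.
From mathcomp Require Import all_classical all_reals all_analysis.

Set Implicit Arguments.
Unset Strict Implicit.
Unset Printing Implicit Defensive.

Import Order.TTheory GRing.Theory Num.Theory.
Import numFieldNormedType.Exports.

Local Open Scope classical_set_scope.
Local Open Scope ring_scope.
Local Open Scope complex_scope.

(* The complex plane is R[i]^o, i.e. R[i] with the topology and normed-module
   structure that MathComp-Analysis puts on the regular algebra of a field; in
   particular is_derive on it is complex differentiation. *)

Definition upper_half_plane (R : realType) : set R[i]^o :=
  [set z | 0 < complex.Im z].

Definition analytic_at (R : realType) (F : R[i]^o -> R[i]^o) (z0 : R[i]^o) :
    Prop :=
  exists a : nat -> R[i]^o, \forall z \near z0,
    [series a i * (z - z0) ^+ i]_i @ \oo --> F z.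

(* The value of F at z0 itself is not constrained. *)
Definition meromorphic_at (R : realType) (F : R[i]^o -> R[i]^o)
    (z0 : R[i]^o) : Prop :=
  exists (k : nat) (h : R[i]^o -> R[i]^o), analytic_at h z0 /\
    \forall z \near z0^', F z = h z / (z - z0) ^+ k.

(* Laurent expansion F z = \sum_i a_i (z - z0)^(i - k) with a_0 != 0, so the
   residue is a_(k - 1). *)
Definition has_pole (R : realType) (F : R[i]^o -> R[i]^o) (z0 : R[i]^o)
    (k : nat) (r : R[i]^o) : Prop :=
  (0 < k)%N /\
  exists a : nat -> R[i]^o,
    [/\ a 0%N != 0, a k.-1 = r &
        \forall z \near z0^',
          [series a i * (z - z0) ^+ i]_i @ \oo --> F z * (z - z0) ^+ k].

(* A function on the upper half-plane is represented by a total function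
   whose values elsewhere are irrelevant. *)
Definition pick_class (R : realType) (f : R[i]^o -> R[i]^o) : Prop :=
  (forall z, upper_half_plane z -> analytic_at f z) /\
  (forall z, upper_half_plane z -> 0 <= complex.Im (f z)).

Definition extends_near (R : realType) (f : R[i]^o -> R[i]^o) (x : R)
    (F : R[i]^o -> R[i]^o) : Prop :=
  \forall z \near (x%:C : R[i]^o), upper_half_plane z -> F z = f z.

Definition analytic_extension (R : realType) (f : R[i]^o -> R[i]^o) (x : R)
    (F : R[i]^o -> R[i]^o) : Prop :=
  (\forall z \near (x%:C : R[i]^o), analytic_at F z) /\ extends_near f x F.

Definition meromorphic_extension (R : realType) (f : R[i]^o -> R[i]^o)
    (x : R) (F : R[i]^o -> R[i]^o) : Prop :=
  (\forall z \near (x%:C : R[i]^o), meromorphic_at F z) /\ extends_near f x F.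

(* f is analytic at the real point x, with f(x) = c and f'(x) = d. *)
Definition boundary_value (R : realType) (f : R[i]^o -> R[i]^o) (x : R)
    (c d : R[i]^o) : Prop :=
  exists F : R[i]^o -> R[i]^o,
    [/\ analytic_extension f x F, F x%:C = c &
        is_derive (x%:C : R[i]^o) 1 F d].

(* f is meromorphic at the real point x, with a pole of order k and residue r. *)
Definition boundary_pole (R : realType) (f : R[i]^o -> R[i]^o) (x : R)
    (k : nat) (r : R[i]^o) : Prop :=
  exists F : R[i]^o -> R[i]^o,
    meromorphic_extension f x F /\ has_pole F x%:C k r.

(* Target values in R \cup {oo} are elements of option R, None being oo. *)
Definition problem_data (R : realType) (n : nat) (x : 'I_n -> R)
    (w : 'I_n -> option R) (v : 'I_n -> R) : Prop :=
  [/\ injective x, forall j, 0 <= v j & forall j, w j = None -> 0 < v j].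

Definition is_solution (R : realType) (n : nat) (x : 'I_n -> R)
    (w : 'I_n -> option R) (v : 'I_n -> R) (f : R[i]^o -> R[i]^o) : Prop :=
  [/\ pick_class f,
      forall j, exists F, meromorphic_extension f (x j) F &
      forall j, match w j with
                | Some c => boundary_value f (x j) c%:C (v j)%:C
                | None => boundary_pole f (x j) 1%N (- (v j)^-1)%:C
                end].

Definition pick_matrix (R : realType) (n : nat) (x : 'I_n -> R)
    (w : 'I_n -> option R) (v : 'I_n -> R) : 'M[R]_n :=
  \matrix_(i, j)
    if i == j then v i else
    match w i, w j with
    | Some a, Some b => (a - b) / (x i - x j)
    | None, Some _ => (x i - x j)^-1
    | Some _, None => (x j - x i)^-1
    | None, None => 0
    end.

(* g is the reduction of f at x; only the values of g on the upper half-plane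
   are determined. *)
Definition is_reduction (R : realType) (f : R[i]^o -> R[i]^o) (x : R)
    (g : R[i]^o -> R[i]^o) : Prop :=
  pick_class f /\
  ((~ (exists c, forall z, upper_half_plane z -> f z = c) /\
    exists (c : R) (d : R[i]^o),
      boundary_value f x c%:C d /\
      forall z, upper_half_plane z ->
        g z = - (f z - c%:C)^-1 + (d * (z - x%:C))^-1)
   \/
   (exists (k : nat) (r : R[i]^o),
      boundary_pole f x k r /\
      forall z, upper_half_plane z -> g z = f z - r / (z - x%:C))).

Definition schur (R : realType) (n : nat) (M : 'M[R]_(1 + n)) : 'M[R]_n :=
  drsubmx M - dlsubmx M *m invmx (ulsubmx M) *m ursubmx M.

(* In the remaining definitions ord0 is the node x_1 and lift ord0 j, for
   j : 'I_n, runs through the nodes x_2, x_3, and so on. *)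

Definition reduced_node (R : realType) (n : nat) (x : 'I_n.+1 -> R)
    (j : 'I_n) : R :=
  x (lift ord0 j).

Definition reduced_value (R : realType) (n : nat) (x : 'I_n.+1 -> R)
    (w : 'I_n.+1 -> option R) (v : 'I_n.+1 -> R) (j : 'I_n) : option R :=
  let xj := x (lift ord0 j) in
  match w ord0, w (lift ord0 j) with
  | Some a, Some b =>
      if b == a then None
      else Some (- (b - a)^-1 + (v ord0 * (xj - x ord0))^-1)
  | Some _, None => Some (v ord0 * (xj - x ord0))^-1
  | None, Some b => Some (b + (v ord0 * (xj - x ord0))^-1)
  | None, None => None
  end.

Definition reduced_slope (R : realType) (n : nat) (x : 'I_n.+1 -> R)
    (w : 'I_n.+1 -> option R) (v : 'I_n.+1 -> R) (j : 'I_n) : R :=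
  let xj := x (lift ord0 j) in
  let vj := v (lift ord0 j) in
  match w ord0, w (lift ord0 j) with
  | Some a, Some b =>
      if b == a then vj
      else vj / (b - a) ^+ 2 - (v ord0 * (xj - x ord0) ^+ 2)^-1
  | Some _, None | None, Some _ =>
      vj - (v ord0 * (xj - x ord0) ^+ 2)^-1
  | None, None => vj
  end.

(* The case w_1 real, w_j = oo needs lambda_j = -1, not 1: for
   f(z) = z - 1/(z - 1) at the nodes 0, -1, 1 one has w = (1, -1/2, oo) and
   v = (2, 5/4, 1), so that the (2,3) entries of schur M and of the reduced
   Pick matrix are -1/4 and 1/6, whereas lambda_2 = 3/2. *)
Definition reduction_scaling (R : realType) (n : nat)
    (w : 'I_n.+1 -> option R) : 'rV[R]_n :=
  \row_j match w ord0, w (lift ord0 j) with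
         | Some a, Some b => if b == a then 1 else a - b
         | Some _, None => -1
         | None, _ => 1
         end.

(* Main.v *)
Require Import Defs.
From mathcomp Require Import all_boot all_order all_algebra.
From mathcomp Require Import complex.
From mathcomp Require Import all_classical all_reals all_analysis.
From mathcomp Require Import ring lra.
Import Order.TTheory GRing.Theory Num.Theory.
Import numFieldNormedType.Exports.
Local Open Scope ring_scope.

(* The engine is the Schwarz-Pick inequality
     Im z Im w |f z - f w|^2 <= Im (f z) Im (f w) |z - w|^2
   on the upper half-plane.  Letting w tend vertically to a boundary node x_1
   where f has a finite value or a simple pole turns it into Julia's
   inequality, which says exactly that the reduction of f at x_1 still has
   non-negative imaginary part; letting z tend to a second node x_j gives
   v_j' >= 0.  The values, slopes and residues of the reduction at the remaining
   nodes are read off from power series, and the identity of Pick matrices is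
   an entrywise computation.

   No complex integration is used: power series are multiplied and inverted
   through explicit remainder estimates, and the maximum principle behind
   Schwarz-Pick comes from averaging |q|^2 + e |z|^2 over four directions. *)

Set Implicit Arguments.
Unset Strict Implicit.
Unset Printing Implicit Defensive.

(** * Modulus and topology of the complex plane *)

Section Modulus.
Local Open Scope complex_scope.
Local Open Scope classical_set_scope.
Variable R : realType.
Local Notation C := (R[i]^o).
Local Notation Re := (@complex.Re R).
Local Notation Im := (@complex.Im R).
Implicit Types (z w : C) (e : R).

(** Two features of the definitions shape the argument. [is_reduction] asserts only that some
    boundary value or some pole exists at x_1, so g is tied to the data only once limits along x_1 +
    it, t -> 0+, are known to determine the value and slope, or the residue of a simple pole. And a
    solution needs an extension on a whole neighbourhood of each node, so one must be built for g;
    near a pole of f this uses that a meromorphic function continuous at a point is analytic there.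
    The inequality between two nodes is the non-negativity of the 2 by 2 minor of the Pick matrix on
    x_1 and x_j. It gives nothing new when w_j = w_1, where v_j' = v_j must even be positive because
    w_j' = oo; there v_j = 0 would make f constant by Julia's inequality at x_j, against v_1 > 0.
    Likewise v_1 > 0 keeps f - w_1 free of zeros in the half-plane when w_1 is real. The norm of
    R[i] is R[i]-valued; [cmod] reads it in R, where all estimates take place. *)

Definition cmod z : R := Re `|z|.

Lemma cmodE z : `|z| = (cmod z)%:C :> R[i].
Proof. by rewrite /cmod normc_def. Qed.

Lemma cmod_ge0 z : 0 <= cmod z.
Proof. by rewrite -ler0c -cmodE. Qed.

Lemma cmod0 : cmod 0 = 0.
Proof. by apply: complexI; rewrite -cmodE normr0. Qed.

Lemma cmod_eq0 z : (cmod z == 0) = (z == 0).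
Proof. by rewrite -[z == 0]normr_eq0 cmodE (inj_eq (@complexI R)). Qed.

Lemma cmod_gt0 z : (0 < cmod z) = (z != 0).
Proof. by rewrite lt_neqAle cmod_ge0 andbT eq_sym cmod_eq0. Qed.

Lemma cmodM z w : cmod (z * w) = cmod z * cmod w.
Proof. by apply: complexI; rewrite rmorphM/= -!cmodE -normrM. Qed.

Lemma cmodX z n : cmod (z ^+ n) = cmod z ^+ n.
Proof. by apply: complexI; rewrite rmorphXn/= -!cmodE -normrX. Qed.

Lemma cmodN z : cmod (- z) = cmod z.
Proof. by apply: complexI; rewrite -!cmodE normrN. Qed.

Lemma cmodV z : cmod z^-1 = (cmod z)^-1.
Proof. by apply: complexI; rewrite fmorphV/= -!cmodE -normfV. Qed.

Lemma cmodD z w : cmod (z + w) <= cmod z + cmod w.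
Proof. by rewrite -lecR rmorphD/= -!cmodE; exact: ler_normD. Qed.

Lemma cmodB z w : cmod (z - w) <= cmod z + cmod w.
Proof. by rewrite -(cmodN w) cmodD. Qed.

Lemma cmod_distC z w : cmod (z - w) = cmod (w - z).
Proof. by rewrite -cmodN opprB. Qed.

Lemma cmod_sum (I : Type) (s : seq I) (P : pred I) (F : I -> C) :
  cmod (\sum_(i <- s | P i) F i) <= \sum_(i <- s | P i) cmod (F i).
Proof.
elim/big_rec2: _ => [|i y z _ le_zy]; first by rewrite cmod0.
by rewrite (le_trans (cmodD _ _))// lerD2l.
Qed.

Lemma cmod_real (x : R) : cmod x%:C = `|x|.
Proof. by rewrite /cmod normc_def/= expr0n addr0 sqrtr_sqr. Qed.

Lemma cmod1 : cmod 1 = 1.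
Proof. by rewrite -[1]/(1%:C) cmod_real normr1. Qed.

Lemma cmod_sqr z : cmod z ^+ 2 = Re z ^+ 2 + Im z ^+ 2.
Proof. by rewrite /cmod normc_def/= sqr_sqrtr// addr_ge0 ?sqr_ge0. Qed.

Lemma ler_Re_cmod z : `|Re z| <= cmod z.
Proof.
by rewrite -(@ler_pXn2r _ 2) ?nnegrE ?cmod_ge0// cmod_sqr real_normK ?num_real// lerDl sqr_ge0.
Qed.

Lemma ler_Im_cmod z : `|Im z| <= cmod z.
Proof.
by rewrite -(@ler_pXn2r _ 2) ?nnegrE ?cmod_ge0// cmod_sqr real_normK ?num_real// lerDr sqr_ge0.
Qed.

Lemma cReD z w : Re (z + w) = Re z + Re w. Proof. by case: z; case: w. Qed.
Lemma cImD z w : Im (z + w) = Im z + Im w. Proof. by case: z; case: w. Qed.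
Lemma cReN z : Re (- z) = - Re z. Proof. by case: z. Qed.
Lemma cImN z : Im (- z) = - Im z. Proof. by case: z. Qed.
Lemma cReM z w : Re (z * w) = Re z * Re w - Im z * Im w.
Proof. by case: z; case: w. Qed.
Lemma cImM z w : Im (z * w) = Re z * Im w + Im z * Re w.
Proof. by case: z; case: w. Qed.

Definition ReImE := (cReD, cImD, cReN, cImN, cReM, cImM).

(** Converts a comparison of |z - w| with the distance from z to the conjugate of w into the sign of
    Im z Im w; this links Cayley quotients to imaginary parts throughout. *)
Lemma cmod_conj_sqr z w : 
  cmod (z - (w^*)%C) ^+ 2 = cmod (z - w) ^+ 2 + 4 * Im z * Im w.
Proof.
have -> : (w^*)%C = Re w -i* Im w by case: w.
rewrite !cmod_sqr !ReImE /=; ring.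
Qed.

Lemma cmod_i : cmod ('i : C) = 1.
Proof.
by apply/eqP; rewrite -(@eqrXn2 _ 2)// ?cmod_ge0// cmod_sqr/= expr0n add0r expr1n.
Qed.

Lemma ballCE z e w : ball z e%:C w <-> cmod (w - z) < e.
Proof. by rewrite -ball_normE/= distrC cmodE ltcR. Qed.

(** A positive element of R[i] is real, so discs of real radius suffice. *)
Lemma nbhsCP z (P : C -> Prop) :
  (\forall w \near z, P w) <->
  exists2 e, 0 < e & forall w, cmod (w - z) < e -> P w.
Proof.
split=> [/nbhs_ballP[e e0 eP]|[e e0 eP]].
  have ee : (Re e)%:C = e by rewrite RRe_real// gtr0_real.
  exists (Re e) => [|w we]; first by rewrite -ltcR ee.
  by apply: eP; rewrite -ee; apply/ballCE.
apply/nbhs_ballP; exists e%:C => /=; first by rewrite ltcR.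
by move=> w /ballCE; exact: eP.
Qed.

Lemma dnbhsCP z (P : C -> Prop) :
  (\forall w \near z^', P w) <->
  exists2 e, 0 < e & forall w, cmod (w - z) < e -> w != z -> P w.
Proof.
rewrite -[\forall w \near z^', P w]/(\forall w \near z, w != z -> P w).
exact: nbhsCP.
Qed.

Lemma cvgCP (T : Type) (G : set_system T) {FG : Filter G} (f : T -> C) z :
  f @ G --> z <-> forall e, 0 < e -> \forall t \near G, cmod (f t - z) < e.
Proof.
split=> [/cvgrPdistC_lt fz e e0|fz].
  have /fz : (0 : R[i]) < e%:C by rewrite ltcR.
  by apply: filterS => t; rewrite cmodE ltcR.
apply/cvgrPdistC_lt => e e0.
have ee : (Re e)%:C = e by rewrite RRe_real// gtr0_real.
have /fz : 0 < Re e by rewrite -ltcR ee.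
by apply: filterS => t; rewrite -ee cmodE ltcR.
Qed.

Lemma cvg_cmod (T : Type) (G : set_system T) {FG : Filter G} (f : T -> C) z :
  f @ G --> z -> cmod (f t) @[t --> G] --> cmod z.
Proof.
move=> /cvgCP fz; apply/cvgrPdistC_lt => e e0.
apply: filterS (fz e e0) => t; apply: le_lt_trans.
rewrite ler_norml; apply/andP; split.
  by have := cmodD (f t) (z - f t); rewrite addrC subrK cmod_distC; lra.
by have := cmodD z (f t - z); rewrite addrC subrK; lra.
Qed.

Lemma cvg_Im (T : Type) (G : set_system T) {FG : Filter G} (f : T -> C) z :
  f @ G --> z -> Im (f t) @[t --> G] --> Im z.
Proof.
move=> /cvgCP fz; apply/cvgrPdistC_lt => e e0.
apply: filterS (fz e e0) => t; apply: le_lt_trans.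
by rewrite -cImN -cImD ler_Im_cmod.
Qed.

Lemma continuousCP (F : C -> C) z : {for z, continuous F} <->
  forall e, 0 < e -> exists2 r, 0 < r &
    forall w, cmod (w - z) < r -> cmod (F w - F z) < e.
Proof.
have FF := nbhs_filter z; have [FP1 FP2] := @cvgCP _ (nbhs z) FF F (F z).
split=> [Fz e e0|Fz]; first by apply/nbhsCP/FP1.
by apply: FP2 => e e0; apply/nbhsCP/Fz.
Qed.

Lemma is_deriveCP (F : C -> C) z (d : C) :
  is_derive z 1 F d <-> forall e, 0 < e -> exists2 r, 0 < r &
    forall h : C, cmod h < r -> cmod (F (z + h) - F z - d * h) <= e * cmod h.
Proof.
have -> : is_derive z 1 F d <->
    h^-1 *: ((F \o shift z) (h *: (1 : C)) - F z) @[h --> dnbhs (@GRing.zero C)] --> d.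
  split=> [[dF <-]|dF]; first exact: dF.
  by split; [exact: (cvgP d)|exact: cvg_lim].
rewrite cvgCP; split=> dF e e0.
  have /dnbhsCP[r r0 rP] := dF e e0.
  exists r => // h hr; have [->|h0] := eqVneq h 0.
    by rewrite addr0 mulr0 subrr subr0 cmod0 mulr0.
  have := rP h; rewrite subr0 => /(_ hr h0) /ltW.
  rewrite -[_ *: 1]/(h * 1) mulr1 /= [h + z]addrC.
  rewrite -(@ler_pM2r _ (cmod h)) ?cmod_gt0// -cmodM.
  rewrite -[_ *: _]/(_ * _) mulrBl mulrAC mulVf// mul1r.
  by apply.
have [|r r0 rP] := dF (e / 2); first by lra.
apply/dnbhsCP; exists r => // h; rewrite subr0 => hr h0.
have := rP h hr.
rewrite -[_ *: 1]/(h * 1) mulr1 /= [h + z]addrC => rPh.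
rewrite -(@ltr_pM2r _ (cmod h)) ?cmod_gt0// -cmodM.
rewrite -[_ *: _]/(_ * _) mulrBl mulrAC mulVf// mul1r (le_lt_trans rPh)//.
by rewrite ltr_pM2r ?cmod_gt0//; lra.
Qed.

End Modulus.

(** * Power series with geometric remainder *)

Section Expansion.
Local Open Scope complex_scope.
Local Open Scope classical_set_scope.
Variable R : realType.
Local Notation C := (R[i]^o).
Implicit Types (F G : C -> C) (z h : C) (a b : nat -> C) (K L : R).

(** L is the inverse of a radius, and one pair K, L serves every order N: order 0 bounds F by K, and
    where L |h| < 1 the partial sums converge to F. *)
Definition expands_with F z a K L := forall N h, L * cmod h <= 1 ->
  cmod (F (z + h) - \sum_(i < N) a i * h ^+ i) <= K * (L * cmod h) ^+ N.

(* A quantitative form of "F is the sum of its power series a near z" that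
   requires no convergence argument to be manipulated. *)
Definition expands F z a := exists K L, 0 < L /\ expands_with F z a K L.

Lemma expands_with_ge0 F z a K L : expands_with F z a K L -> 0 <= K.
Proof.
move=> /(_ 0%N 0); rewrite cmod0 mulr0 ler01 big_ord0 expr0 mulr1 subr0 => /(_ isT).
exact: le_trans (cmod_ge0 _).
Qed.

Lemma expands_withW F z a K L K' L' : 0 < L -> K <= K' -> L <= L' ->
  expands_with F z a K L -> expands_with F z a K' L'.
Proof.
move=> L0 KK LL Fa N h h1.
have K0 := expands_with_ge0 Fa.
have hL : L * cmod h <= L' * cmod h by rewrite ler_wpM2r// cmod_ge0.
rewrite (le_trans (Fa N h (le_trans hL h1)))// ler_pM// ?exprn_ge0 ?mulr_ge0 ?cmod_ge0 ?(ltW L0)//.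
by rewrite lerXn2r// ?nnegrE ?mulr_ge0 ?cmod_ge0 ?(ltW L0)// (le_trans (ltW L0)).
Qed.

Lemma expands_common F G z a b : expands F z a -> expands G z b ->
  exists K L, [/\ 0 <= K, 0 < L, expands_with F z a K L & expands_with G z b K L].
Proof.
move=> [K [L [L0 Fa]]] [K' [L' [L'0 Gb]]].
have K0 := expands_with_ge0 Fa; have K'0 := expands_with_ge0 Gb.
exists (K + K'), (L + L'); split.
- by rewrite addr_ge0.
- by rewrite addr_gt0.
- by apply: expands_withW Fa => //; rewrite lerDl// ltW.
- by apply: expands_withW Gb => //; rewrite lerDr// ltW.
Qed.

Lemma expands_near F G z a : expands F z a ->
  (\forall w \near z, G w = F w) -> expands G z a.
Proof.
move=> [K [L [L0 Fa]]] /nbhsCP[e e0 GF].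
(* With 2 / e added to L, the disc shrinks to |h| <= e / 2, where G and F agree. *)
have {}Fa : expands_with F z a K (L + 2 / e).
  by apply: expands_withW Fa => //; rewrite lerDl divr_ge0// ltW.
exists K, (L + 2 / e); split; first by rewrite addr_gt0// divr_gt0.
move=> N h h1; rewrite GF; first exact: Fa.
rewrite addrC addKr.
have : 2 / e * cmod h <= 1.
  by apply: le_trans h1; rewrite ler_wpM2r ?cmod_ge0// lerDr ltW.
rewrite mulrAC ler_pdivrMr//; have := cmod_ge0 h; lra.
Qed.

Lemma expands_ext F G z a : (forall w, G w = F w) -> expands F z a -> expands G z a.
Proof. by move=> /funext ->. Qed.

Lemma expands_center F z a : expands F z a -> F z = a 0%N.
Proof.
move=> [K [L [L0 /(_ 1%N 0)]]].
rewrite cmod0 mulr0 ler01 big_ord1 expr0 mulr1 addr0 expr1 mulr0 => /(_ isT).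
move=> F0; apply/eqP; rewrite -subr_eq0 -cmod_eq0.
by rewrite eq_le F0 cmod_ge0.
Qed.

(** At |h| = 1 / L the remainders of orders N and N + 1 are both at most K, and they differ by a_N
    h^N. *)
Lemma expands_coef F z a K L N : 0 < L -> expands_with F z a K L ->
  cmod (a N) <= 2 * K * L ^+ N.
Proof.
move=> L0 Fa; pose h : C := (L^-1)%:C.
have ch : L * cmod h = 1 by rewrite cmod_real gtr0_norm ?invr_gt0// divff// gt_eqF.
have := Fa N.+1 h; have := Fa N h; rewrite ch lexx !expr1n mulr1 => /(_ isT) A1 /(_ isT) A2.
have : cmod (a N * h ^+ N) <= 2 * K.
  have -> : a N * h ^+ N = (F (z + h) - \sum_(i < N) a i * h ^+ i) -
                           (F (z + h) - \sum_(i < N.+1) a i * h ^+ i).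
    rewrite big_ord_recr/=; ring.
  apply: le_trans (cmodB _ _) _; lra.
have -> : cmod (a N) = cmod (a N * h ^+ N) * L ^+ N.
  by rewrite cmodM cmodX -mulrA -exprMn [cmod h * L]mulrC ch expr1n mulr1.
by move=> aN; rewrite ler_wpM2r// exprn_ge0// ltW.
Qed.

Lemma geometric_sum_le2 (q : R) n : 0 <= q -> q <= 1 / 2 ->
  \sum_(i < n) q ^+ i <= 2.
Proof.
move=> q0 q2.
have := subrX1 q n; have : 0 <= q ^+ n by exact: exprn_ge0.
set S := \sum_(i < n) _; set Q := q ^+ n => Q0 E.
have S0 : 0 <= S by apply: sumr_ge0 => i _; exact: exprn_ge0.
nra.
Qed.

Lemma expands_continuous_center F z a : expands F z a -> {for z, continuous F}.
Proof.
move=> Fa; have F0 := expands_center Fa; case: Fa => K [L [L0 Fa]].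
have K0 := expands_with_ge0 Fa.
apply/continuousCP => e e0.
have KL : 0 <= K * L by rewrite mulr_ge0// ltW.
exists (Num.min (L^-1) (e / (K * L + 1))).
  by rewrite lt_min invr_gt0 L0 divr_gt0// ltr_pwDr.
move=> w; rewrite lt_min => /andP[h1 h2]; set h := w - z in h1 h2.
have wE : w = z + h by rewrite addrC subrK.
have hL : L * cmod h <= 1 by rewrite -ler_pdivlMl// mulr1 ltW.
have := Fa 1%N h hL; rewrite -wE F0 big_ord1 expr0 mulr1 expr1 => /le_lt_trans; apply.
move: h2; rewrite ltr_pdivlMr ?ltr_pwDr//; apply: le_lt_trans.
by have := cmod_ge0 h; nra.
Qed.

Lemma expands_is_derive F z a : expands F z a -> is_derive z 1 F (a 1%N).
Proof.
move=> Fa; have F0 := expands_center Fa; case: Fa => K [L [L0 Fa]].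
have K0 := expands_with_ge0 Fa.
apply/is_deriveCP => e e0.
exists (Num.min (L^-1) (e / ((K + 1) * L ^+ 2))).
  by rewrite lt_min invr_gt0 L0 divr_gt0// mulr_gt0 ?exprn_gt0// ltr_pwDr.
move=> h; rewrite lt_min => /andP[h1 h2].
have := Fa 2%N h; rewrite !big_ord_recr big_ord0/= expr0 mulr1 add0r expr1 F0 opprD addrA.
have hL : L * cmod h <= 1 by rewrite -ler_pdivlMl// mulr1 ltW.
move=> /(_ hL) /le_trans; apply.
move: h2; rewrite ltr_pdivlMr ?mulr_gt0 ?exprn_gt0 ?ltr_pwDr// => /ltW h2.
rewrite exprMn [cmod h ^+ 2]expr2 !mulrA ler_wpM2r ?cmod_ge0//.
apply: le_trans h2; rewrite [leRHS]mulrC ler_wpM2r ?cmod_ge0//.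
have := sqr_ge0 L; nra.
Qed.

Lemma expands_cst (c : C) z : expands (fun=> c) z (fun n => if n == 0%N then c else 0).
Proof.
exists (cmod c), 1; split=> // N h _; case: N => [|N].
  by rewrite big_ord0 subr0 expr0 mulr1.
rewrite big_ord_recl/= expr0 mulr1 big1 => [|i _]; last by rewrite mul0r.
by rewrite addr0 subrr cmod0 mulr_ge0 ?exprn_ge0 ?mulr_ge0 ?cmod_ge0.
Qed.

Lemma expands_id z : expands id z
  (fun n => if n == 0%N then z else if n == 1%N then 1 else 0).
Proof.
exists (cmod z + 1), 1; split=> // N h; rewrite mul1r => h1.
have h0 := cmod_ge0 h; have z0 := cmod_ge0 z.
case: N => [|[|N]].
- rewrite big_ord0 subr0 expr0 mulr1; apply: le_trans (cmodD _ _) _; lra.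
- rewrite big_ord1 expr0 mulr1 addrC addKr expr1; nra.
rewrite !big_ord_recl/= expr0 mulr1 big1 => [|i _]; last by rewrite mul0r.
by rewrite addr0 mul1r expr1 subrr cmod0 mulr_ge0 ?exprn_ge0 ?addr_ge0.
Qed.

Lemma expandsD F G z a b : expands F z a -> expands G z b ->
  expands (fun w => F w + G w) z (fun n => a n + b n).
Proof.
move=> Fa Gb; have [K [L [K0 L0 {}Fa {}Gb]]] := expands_common Fa Gb.
exists (K + K), L; split=> // N h h1.
under eq_bigr => i _ do rewrite mulrDl.
rewrite big_split/= opprD addrACA mulrDl.
by apply: le_trans (cmodD _ _) _; rewrite lerD ?Fa ?Gb.
Qed.

(** The triangle i + j < N is summed by rows, so that row i meets the partial sum of order N - i of
    the second series and hence its remainder of that order. *)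
Lemma convolution_partial_sum (a b : nat -> C) (h : C) N :
  \sum_(n < N) (\sum_(i < n.+1) a i * b (n - i)%N) * h ^+ n =
  \sum_(i < N) a i * h ^+ i * \sum_(j < N - i) b j * h ^+ j.
Proof.
elim: N => [|N IH]; first by rewrite !big_ord0.
rewrite big_ord_recr/= IH [RHS]big_ord_recr/= subSnn big_ord1 expr0 mulr1.
under [X in _ = X + _]eq_bigr => i _ do
  rewrite subSn 1?ltnW// big_ord_recr/= mulrDr.
rewrite big_split/= -addrA; congr (_ + _).
rewrite big_ord_recr/= mulrDl subnn mulr_suml; congr (_ + _); last by ring.
apply: eq_bigr => i _; have -> : h ^+ N = h ^+ i * h ^+ (N - i).
  by rewrite -exprD subnKC// ltnW.
ring.
Qed.

(** The product remainder consists of one term and N terms twice as large; enlarging L to 3 L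
    absorbs the factor 2 N + 1. *)
Lemma double_succ_le_exp3 N : (2 * N%:R + 1 : R) <= 3 ^+ N.
Proof.
elim: N => [|N IH]; first by rewrite expr0; lra.
rewrite exprS -natr1; have : (0 : R) <= N%:R by []; lra.
Qed.

Lemma expandsM F G z a b : expands F z a -> expands G z b ->
  expands (fun w => F w * G w) z (fun n => \sum_(i < n.+1) a i * b (n - i)%N).
Proof.
move=> Fa Gb; have [K [L [K0 L0 {}Fa {}Gb]]] := expands_common Fa Gb.
exists (K ^+ 2), (3 * L); split=> [|N h h1]; first by rewrite mulr_gt0.
have ch := cmod_ge0 h; set q := L * cmod h.
have q0 : 0 <= q by rewrite mulr_ge0// ltW.
have q1 : q <= 1 by rewrite /q; nra.
rewrite convolution_partial_sum.
(* One remainder of F of order N, plus one remainder of G of order N - i for each coefficient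
   a_i. *)
have -> : F (z + h) * G (z + h) - \sum_(i < N) a i * h ^+ i * \sum_(j < N - i) b j * h ^+ j =
  (F (z + h) - \sum_(i < N) a i * h ^+ i) * G (z + h) +
  \sum_(i < N) a i * h ^+ i * (G (z + h) - \sum_(j < N - i) b j * h ^+ j).
  under [X in _ = _ + X]eq_bigr => i _ do rewrite mulrBr.
  by rewrite big_split/= sumrN mulrBl -mulr_suml addrA subrK.
apply: le_trans (cmodD _ _) _.
have A1 : cmod ((F (z + h) - \sum_(i < N) a i * h ^+ i) * G (z + h)) <= K ^+ 2 * q ^+ N.
  rewrite cmodM expr2 mulrAC ler_pM ?cmod_ge0 ?Fa//.
  by have := Gb 0%N h q1; rewrite big_ord0 subr0 expr0 mulr1.
have A2 : cmod (\sum_(i < N) a i * h ^+ i * (G (z + h) - \sum_(j < N - i) b j * h ^+ j))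
   <= \sum_(i < N) 2 * K ^+ 2 * q ^+ N.
  apply: le_trans (cmod_sum _ _ _) _; apply: ler_sum => i _.
  have -> : 2 * K ^+ 2 * q ^+ N = (2 * K * q ^+ i) * (K * q ^+ (N - i)).
    by rewrite -{1}(subnKC (ltnW (ltn_ord i))) exprD; ring.
  rewrite cmodM ler_pM ?cmod_ge0// ?Gb//.
  rewrite cmodM cmodX exprMn mulrA ler_wpM2r ?exprn_ge0//.
  exact: expands_coef Fa.
apply: le_trans (lerD A1 A2) _.
have -> : 3 * L * cmod h = 3 * q by rewrite mulrA.
rewrite sumr_const card_ord [(3 * q) ^+ _]exprMn.
have -> : K ^+ 2 * q ^+ N + (2 * K ^+ 2 * q ^+ N) *+ N =
  (2 * N%:R + 1) * (K ^+ 2 * q ^+ N) by rewrite -[X in _ + X]mulr_natr; ring.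
by rewrite [leRHS]mulrCA ler_wpM2r ?double_succ_le_exp3// mulr_ge0 ?exprn_ge0.
Qed.

Lemma expandsZ F z a (c : C) : expands F z a ->
  expands (fun w => c * F w) z (fun n => c * a n).
Proof.
move=> [K [L [L0 Fa]]]; exists (cmod c * K), L; split=> // N h h1.
under eq_bigr => i _ do rewrite -mulrA.
by rewrite -mulr_sumr -mulrBr cmodM -mulrA ler_wpM2l ?cmod_ge0 ?Fa.
Qed.

(** Removes a zero at the centre, filling in the value a_1 there: this serves both for removable
    singularities and for splitting off simple zeros. *)
Lemma expands_divX F z a : a 0%N = 0 -> expands F z a ->
  expands (fun w => if w == z then a 1%N else F w / (w - z)) z (fun n => a n.+1).
Proof.
(* The factor 2 is for h = 0, N = 0, where the bound needed is |a_1| <= 2 K L; elsewhere K L is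
   enough. *)
move=> a0 [K [L [L0 Fa]]]; exists (2 * K * L), L; split=> // N h h1.
have K0 := expands_with_ge0 Fa; have ch := cmod_ge0 h.
have [->|h0] := eqVneq h 0.
  rewrite addr0 eqxx cmod0 mulr0; case: N => [|N].
    rewrite big_ord0 subr0 expr0 mulr1; have := expands_coef 1%N L0 Fa.
    by rewrite expr1.
  rewrite big_ord_recl/= expr0 mulr1 big1 => [|i _]; last by rewrite exprS mul0r mulr0.
  by rewrite addr0 subrr cmod0 expr0n mulr0.
have -> : (z + h == z) = false by rewrite -subr_eq0 addrC addKr (negbTE h0).
rewrite [z + h - z]addrC addKr -(@ler_pM2r _ (cmod h)) ?cmod_gt0// -cmodM.
rewrite mulrBl divfK// mulr_suml.
have := Fa N.+1 h h1; rewrite big_ord_recl/= a0 mul0r add0r.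
have -> : \sum_(i < N) a (lift ord0 i) * h ^+ lift ord0 i = \sum_(i < N) a i.+1 * h ^+ i * h.
  by apply: eq_bigr => i _; rewrite lift0 exprSr mulrA.
move=> /le_trans; apply.
rewrite exprSr !mulrA [_ * L * _ ^+ _]mulrAC ler_wpM2r// ler_wpM2r ?(ltW L0)//.
have : 0 <= K * (L * cmod h) ^+ N by rewrite mulr_ge0 ?exprn_ge0 ?mulr_ge0// ltW.
lra.
Qed.

(** With c = 1 / a_0 the recursion says that the coefficients of positive order of the product of
    the two series vanish. Each term needs all earlier ones, so the recursion carries the list of
    b_0, ..., b_n. *)
Lemma recursive_inverse_coefs (a : nat -> C) (c : C) : exists b : nat -> C,
  b 0%N = c /\ forall n, b n.+1 = - c * \sum_(i < n.+1) a i.+1 * b (n - i)%N.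
Proof.
pose fix g n : seq C := if n is m.+1 then
  rcons (g m) (- c * \sum_(i < m.+1) a i.+1 * nth 0 (g m) (m - i)%N) else [:: c].
have sg n : size (g n) = n.+1 by elim: n => //= n IH; rewrite size_rcons IH.
have gE m n : (n <= m)%N -> nth 0 (g m) n = nth 0 (g n) n.
  elim: m => [|m IH]; first by rewrite leqn0 => /eqP ->.
  rewrite leq_eqVlt => /orP[/eqP -> //|]; rewrite ltnS => nm.
  by rewrite /= nth_rcons sg ltnS nm IH.
exists (fun n => nth 0 (g n) n); split=> // n.
rewrite /= nth_rcons sg ltnn eqxx; congr (_ * _).
by apply: eq_bigr => i _; rewrite gE// leq_subr.
Qed.

(** With b the formal inverse and B_N its partial sum, 1/F - B_N = (1/F) (1 - F B_N), and 1 - F B_N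
    is a combination of remainders of F, since the convolution of a and b is 1. *)
Lemma expandsV F z a : a 0%N != 0 -> expands F z a ->
  exists b, [/\ expands (fun w => (F w)^-1) z b, b 0%N = (a 0%N)^-1 &
               b 1%N = - a 1%N / a 0%N ^+ 2].
Proof.
move=> a0 [K [L [L0 Fa]]].
have K0 := expands_with_ge0 Fa.
have [b [b0 bS]] := recursive_inverse_coefs a (a 0%N)^-1.
exists b; split=> //; last first.
  rewrite bS big_ord1 subnn b0 expr2 invfM; ring.
have ca0 : 0 < cmod (a 0%N) by rewrite cmod_gt0.
set B := (cmod (a 0%N))^-1; have B0 : 0 < B by rewrite invr_gt0.
pose k := 2 * K * B; have k0 : 0 <= k by rewrite mulr_ge0 ?(ltW B0)//; lra.
(* As k L = s - L, the sum of k L s^(n-i) L^i over i <= n telescopes to s^(n+1) - L^(n+1), which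
   closes the induction for |b_n| <= B s^n. *)
pose s := L * (1 + k); have s0 : 0 < s by rewrite mulr_gt0//; lra.
have Ls : L <= s by rewrite /s; nra.
have bB n : cmod (b n) <= B * s ^+ n.
  elim/ltn_ind: n => -[_|n IH]; first by rewrite b0 cmodV expr0 mulr1.
  rewrite bS cmodM cmodN cmodV -/B ler_wpM2l ?(ltW B0)//.
  apply: le_trans (cmod_sum _ _ _) _.
  apply: (@le_trans _ _ (\sum_(i < n.+1) k * L * (s ^+ (n - i) * L ^+ i))).
    apply: ler_sum => i _; rewrite cmodM.
    have -> : k * L * (s ^+ (n - i) * L ^+ i) =
       (2 * K * L ^+ i.+1) * (B * s ^+ (n - i)) by rewrite exprS /k; ring.
    by rewrite ler_pM ?cmod_ge0 ?(expands_coef _ L0 Fa)// IH// ltnS leq_subr.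
  rewrite -mulr_sumr; have -> : k * L = s - L by rewrite /s; ring.
  by have /= <- := subrXX s L n.+1; rewrite lerBlDr lerDl exprn_ge0// ltW.
have cE n : \sum_(i < n.+1) b i * a (n - i)%N = if n == 0%N then 1 else 0.
  case: n => [|n]; first by rewrite big_ord1 subnn b0 mulVf.
  rewrite big_ord_recr/= subnn bS mulrAC mulNr mulVf// mulN1r.
  apply/eqP; rewrite subr_eq0; apply/eqP; rewrite (reindex_inj rev_ord_inj)/=.
  by apply: eq_bigr => i _; rewrite subSS mulrC subSn ?leq_subr// subKn -1?ltnS.
have bE N h : 1 - F (z + h) * \sum_(j < N.+1) b j * h ^+ j =
    - \sum_(j < N.+1) b j * h ^+ j * (F (z + h) - \sum_(i < N.+1 - j) a i * h ^+ i).
  under [X in _ = - X]eq_bigr => j _ do rewrite mulrBr.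
  have S1 : \sum_(n < N.+1) (\sum_(i < n.+1) b i * a (n - i)%N) * h ^+ n = 1.
    under eq_bigr => n _ do rewrite cE.
    by rewrite big_ord_recl big1 => [|i _]; rewrite ?mul0r// expr0 mulr1 addr0.
  rewrite sumrB -convolution_partial_sum S1 -mulr_suml; ring.
(* The summand k L keeps |F| >= |a_0| / 2, whence the factor 2 B for 1/F. Doubling s absorbs the
   number of remainders, at most 2^N. In 1 + B K the 1 covers N = 0 and B K the other orders. *)
exists (2 * B * (1 + B * K)), (2 * s + k * L); split.
  by have : 0 <= k * L := mulr_ge0 k0 (ltW L0); lra.
move=> N h h1; have ch := cmod_ge0 h.
have sh : 2 * (s * cmod h) <= 1.
  by apply: le_trans h1; rewrite mulrA ler_wpM2r// lerDl mulr_ge0// ltW.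
have kh : k * L * cmod h <= 1.
  by apply: le_trans h1; rewrite ler_wpM2r// lerDr mulr_ge0// ltW.
have sh0 : 0 <= s * cmod h by rewrite mulr_ge0// ltW.
have Lh : L * cmod h <= 1 by have : L * cmod h <= s * cmod h by [rewrite ler_wpM2r]; lra.
have F2 : cmod (a 0%N) / 2 <= cmod (F (z + h)).
  have := Fa 1%N h Lh; rewrite big_ord1 expr0 mulr1 expr1 => A1.
  have : K * (L * cmod h) <= cmod (a 0%N) / 2.
    have : k * L * cmod h * cmod (a 0%N) <= cmod (a 0%N) by rewrite ger_pMl.
    have -> : k * L * cmod h * cmod (a 0%N) = 2 * (K * (L * cmod h)).
      by rewrite /k -[RHS]mulr1 -(mulVf (lt0r_neq0 ca0)) -/B; ring.
    lra.
  have := cmodB (F (z + h)) (F (z + h) - a 0%N); rewrite subKr; lra.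
have F0 : F (z + h) != 0 by rewrite -cmod_gt0; lra.
have cFV : cmod (F (z + h))^-1 <= 2 * B.
  have -> : 2 * B = (cmod (a 0%N) / 2)^-1 by rewrite /B invfM invrK mulrC.
  by rewrite cmodV lef_pV2 ?posrE//; lra.
have -> : (F (z + h))^-1 - \sum_(i < N) b i * h ^+ i =
    (F (z + h))^-1 * (1 - F (z + h) * \sum_(j < N) b j * h ^+ j).
  by rewrite mulrBr mulr1 mulrA mulVf// mul1r.
rewrite cmodM -[leRHS]mulrA; apply: ler_pM; rewrite ?cmod_ge0//.
case: N => [|N].
  by rewrite big_ord0 mulr0 subr0 expr0 mulr1 cmod1 lerDl mulr_ge0// ltW.
apply: (@le_trans _ _ (B * K * (2 * (s * cmod h)) ^+ N.+1)); last first.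
  have t1 : 2 * (s * cmod h) <= (2 * s + k * L) * cmod h.
    by rewrite mulrA ler_wpM2r// lerDl mulr_ge0// ltW.
  have t0 : 0 <= 2 * (s * cmod h) by lra.
  have BK : 0 <= B * K by rewrite mulr_ge0// ltW.
  apply: ler_pM; rewrite ?exprn_ge0//; first by lra.
  by rewrite lerXn2r// nnegrE (le_trans t0).
rewrite bE cmodN; apply: le_trans (cmod_sum _ _ _) _.
apply: (@le_trans _ _ (\sum_(j < N.+1) B * K * (s * cmod h) ^+ N.+1)).
  apply: ler_sum => j _.
  have -> : B * K * (s * cmod h) ^+ N.+1 =
     (B * s ^+ j * cmod h ^+ j) * (K * (s * cmod h) ^+ (N.+1 - j)).
    by rewrite -{1}(subnKC (ltnW (ltn_ord j))) exprD exprMn; ring.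
  rewrite cmodM ler_pM ?cmod_ge0//.
    by rewrite cmodM cmodX ler_wpM2r ?exprn_ge0.
  apply: le_trans (Fa _ _ Lh) _; rewrite ler_wpM2l//.
  by rewrite lerXn2r// ?nnegrE ?mulr_ge0 ?(ltW L0)// ler_wpM2r.
rewrite sumr_const card_ord.
set t := B * K * (s * cmod h) ^+ N.+1.
have -> : t *+ N.+1 = N.+1%:R * t by rewrite mulr_natl.
have -> : B * K * (2 * (s * cmod h)) ^+ N.+1 = 2 ^+ N.+1 * t by rewrite exprMn mulrCA.
rewrite ler_wpM2r ?mulr_ge0 ?exprn_ge0 ?(ltW B0)//.
by rewrite -natrX ler_nat ltnW// ltn_expl.
Qed.

(** Convergence at the single point z + r bounds |a_n| r^n, and comparison with a geometric series
    then bounds every tail. *)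
Lemma series_expands F z a :
  (\forall w \near z, [series a i * (w - z) ^+ i]_i @ \oo --> F w) -> expands F z a.
Proof.
move=> /nbhsCP[e e0 aF].
pose r := e / 2; have r0 : 0 < r by rewrite divr_gt0.
have [M [M0 aM]] : exists M : R, 0 <= M /\ forall n, cmod (a n) * r ^+ n <= M.
  have := aF (z + r%:C); rewrite addrC addKr cmod_real gtr0_norm// => /(_ _)/cvgCP.
  have re : r < e by rewrite /r; lra.
  move=> /(_ re 1 ltr01)[N _ NP].
  have S0 : 0 <= \sum_(i < N) cmod (a i) * r ^+ i.
    by apply: sumr_ge0 => i _; rewrite mulr_ge0 ?cmod_ge0 ?exprn_ge0 ?ltW.
  (* Beyond N a term is the difference of two partial sums within 1 of the limit; the earlier terms
     are bounded by their sum. *)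
  exists (2 + \sum_(i < N) cmod (a i) * r ^+ i); split=> [|n]; first by lra.
  have [nN|Nn] := ltnP n N.
    rewrite (bigD1 (Ordinal nN))//= addrA addrAC lerDr addr_ge0//.
    by apply: sumr_ge0 => i _; rewrite mulr_ge0 ?cmod_ge0 ?exprn_ge0 ?ltW.
  have := NP n Nn; have := NP n.+1 (leqW Nn) => /= A1 A2.
  have : cmod (a n) * r ^+ n <= 2; last by lra.
  have -> : cmod (a n) * r ^+ n = cmod (a n * (r%:C : C) ^+ n).
    by rewrite cmodM cmodX cmod_real gtr0_norm.
  move: A1; rewrite seriesSr => A1.
  set S := series _ n in A1 A2; set l := F _ in A1 A2.
  have -> : a n * (r%:C : C) ^+ n = (S + a n * (r%:C : C) ^+ n - l) - (S - l) by ring.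
  by apply: le_trans (cmodB _ _) _; lra.
(* Taking L = 2 / r forces the ratio |h| / r to be at most 1/2, so a geometric tail is at most twice
   its first term. *)
exists (2 * M), (2 / r); split=> [|N h h1]; first by rewrite divr_gt0.
have ch := cmod_ge0 h.
set q := cmod h / r; have q0 : 0 <= q by rewrite divr_ge0// ltW.
have hq : 2 / r * cmod h = 2 * q by rewrite /q mulrAC mulrA.
rewrite hq in h1 *.
have he : cmod h < e.
  have -> : cmod h = q * r by rewrite /q divfK// gt_eqF.
  by rewrite /r; nra.
have := aF (z + h); rewrite addrC addKr => /(_ he)/cvgCP hF.
have tail n : (N <= n)%N -> cmod (\sum_(i < n) a i * h ^+ i - \sum_(i < N) a i * h ^+ i)
   <= 2 * M * q ^+ N.
  move=> /subnKC <-; rewrite big_split_ord/= addrAC subrr add0r.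
  apply: le_trans (cmod_sum _ _ _) _.
  apply: (@le_trans _ _ (\sum_(i < n - N) M * q ^+ N * q ^+ i)).
    apply: ler_sum => i _; rewrite -mulrA -exprD cmodM cmodX.
    have -> : cmod h = q * r by rewrite /q divfK// gt_eqF.
    by rewrite exprMn [q ^+ _ * _]mulrC mulrA ler_wpM2r ?exprn_ge0.
  have -> : 2 * M * q ^+ N = M * q ^+ N * 2 by ring.
  rewrite -mulr_sumr ler_wpM2l ?mulr_ge0 ?exprn_ge0//.
  by apply: geometric_sum_le2 => //; lra.
apply/ler_addgt0Pr => d d0.
have [n0 _ n0P] := hF d d0.
have := n0P (maxn n0 N) (leq_maxl _ _); rewrite /series/= big_mkord => A1.
have A2 := tail (maxn n0 N) (leq_maxr _ _).
have A3 : 2 * M * q ^+ N <= 2 * M * (2 * q) ^+ N.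
  have q2 : q <= 2 * q by lra.
  by rewrite ler_wpM2l ?mulr_ge0// lerXn2r// ?nnegrE mulr_ge0.
set S := \sum_(i < maxn n0 N) _ in A1 A2; set SN := \sum_(i < N) _ in A2 *.
have -> : F (z + h) - SN = (S - SN) - (S - F (z + h)) by ring.
by apply: le_trans (cmodB _ _) _; lra.
Qed.

Lemma expands_series F z a : expands F z a ->
  \forall w \near z, [series a i * (w - z) ^+ i]_i @ \oo --> F w.
Proof.
move=> [K [L [L0 Fa]]]; have K0 := expands_with_ge0 Fa.
apply/nbhsCP; exists (2 * L)^-1 => [|w wz]; first by rewrite invr_gt0 mulr_gt0.
set h := w - z; have ch := cmod_ge0 h.
set q := L * cmod h; have q0 : 0 <= q by rewrite mulr_ge0// ltW.
have q2 : q < 1 / 2.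
  by move: wz; rewrite -/h -[_^-1]mul1r ltr_pdivlMr ?mulr_gt0// /q; lra.
apply/cvgCP => e e0.
have /cvgrPdistC_lt : K * (1 / 2 : R) ^+ n @[n --> \oo] --> K * 0.
  by apply: cvgMr; apply: cvg_expr; rewrite ger0_norm; lra.
move=> /(_ e e0); apply: filterS => n; rewrite mulr0 subr0 => nK.
rewrite /series/= big_mkord cmod_distC.
have zh : z + h = w by rewrite addrC subrK.
have := Fa n h; rewrite -/q zh => /(_ _)/le_lt_trans; apply; first by lra.
apply: le_lt_trans nK; rewrite ger0_norm; last by rewrite mulr_ge0// exprn_ge0//; lra.
by rewrite ler_wpM2l// lerXn2r// ?nnegrE//; lra.
Qed.

(** On the disc of radius 1 / (2 L) the partial sums converge uniformly, so F is continuous there.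
    Continuity off the centre, joined to meromorphy, replaces re-expanding the series at nearby
    points. *)
Lemma expands_continuous F z a : expands F z a ->
  \forall w \near z, {for w, continuous F}.
Proof.
move=> [K [L [L0 Fa]]]; have K0 := expands_with_ge0 Fa.
have L2 : 0 < (2 * L)^-1 by rewrite invr_gt0 mulr_gt0.
have near2 u : cmod (u - z) < (2 * L)^-1 -> forall N,
    cmod (F u - \sum_(i < N) a i * (u - z) ^+ i) <= K * (1 / 2) ^+ N.
  move=> uz N; set h := u - z in uz *; have ch := cmod_ge0 h.
  have q2 : L * cmod h < 1 / 2.
    by move: uz; rewrite -[_^-1]mul1r ltr_pdivlMr ?mulr_gt0//; lra.
  have zh : z + h = u by rewrite addrC subrK.
  have := Fa N h; rewrite zh => /(_ _)/le_trans; apply; first by lra.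
  by rewrite ler_wpM2l// lerXn2r// ?nnegrE ?mulr_ge0 ?(ltW L0)//; lra.
apply/nbhsCP; exists (2 * L)^-1 => // w wz.
apply/continuousCP => e e0.
have /cvgrPdistC_lt : K * (1 / 2 : R) ^+ n @[n --> \oo] --> K * 0.
  by apply: cvgMr; apply: cvg_expr; rewrite ger0_norm; lra.
have e3 : 0 < e / 3 by lra.
move=> /(_ _ e3)[N _ /(_ N (leqnn N))]/=; rewrite mulr0 subr0 => NK.
have {}NK : K * (1 / 2) ^+ N < e / 3 := le_lt_trans (ler_norm _) NK.
have [c Sc] : exists c, expands (fun u => \sum_(i < N) a i * (u - z) ^+ i) w c.
  elim: N {NK} => [|N [c Sc]].
    by eexists; apply: expands_ext (expands_cst 0 w) => u; rewrite big_ord0.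
  have [b Xb] : exists b, expands (fun u => (u - z) ^+ N) w b.
    elim: N {c Sc} => [|N [b Xb]]; first by eexists; exact: expands_cst.
    eexists; apply: expands_ext (expandsM (expandsD (expands_id w) (expands_cst (- z) w)) Xb).
    by move=> u; rewrite exprS.
  eexists; apply: expands_ext (expandsD Sc (expandsZ (a N) Xb)) => u.
  by rewrite big_ord_recr.
have /continuousCP/(_ _ e3)[d d0 dP] := expands_continuous_center Sc.
exists (Num.min d ((2 * L)^-1 - cmod (w - z))).
  by rewrite lt_min d0 subr_gt0.
move=> u; rewrite lt_min => /andP[ud uL].
have uz : cmod (u - z) < (2 * L)^-1.
  have -> : u - z = (u - w) + (w - z) by ring.
  by apply: le_lt_trans (cmodD _ _) _; lra.
have := dP u ud; have := near2 u uz N; have := near2 w wz N.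
set Su := \sum_(i < N) _ * (u - z) ^+ _; set Sw := \sum_(i < N) _ => A1 A2 A3.
have -> : F u - F w = (F u - Su) + (Su - Sw) - (F w - Sw) by ring.
by apply: le_lt_trans (cmodB _ _) _; have := cmodD (F u - Su) (Su - Sw); lra.
Qed.

End Expansion.

(** * Maximum principle *)

Section MaximumPrinciple.
Local Open Scope complex_scope.
Local Open Scope classical_set_scope.
Variable R : realType.
Local Notation C := (R[i]^o).
Local Notation Re := (@complex.Re R).
Local Notation Im := (@complex.Im R).
Implicit Types (f q : C -> C) (z w h : C) (a : nat -> C) (e r : R).

Lemma parallelogram z w :
  cmod (z + w) ^+ 2 + cmod (z - w) ^+ 2 = 2 * cmod z ^+ 2 + 2 * cmod w ^+ 2.
Proof. by rewrite !cmod_sqr !ReImE; ring. Qed.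

(* The cross terms of second-order Taylor polynomials cancel when summed over
   the four directions h, ih, -h, -ih. *)
Lemma four_directions (a0 a1 a2 h : C) :
  4 * cmod a0 ^+ 2 <= \sum_(d <- [:: 1; 'i; -1; - 'i])
    cmod (a0 + a1 * (d * h) + a2 * (d * h) ^+ 2) ^+ 2.
Proof.
rewrite !big_cons big_nil addr0; pose b := a2 * h ^+ 2.
have E (d s : C) : d ^+ 2 = s ->
    a0 + a1 * (d * h) + a2 * (d * h) ^+ 2 = (a0 + s * b) + d * (a1 * h).
  by move=> <-; rewrite /b; ring.
rewrite (E 1 1) ?expr1n// (E (-1) 1) ?sqrrN ?expr1n//.
rewrite (E 'i (-1)) ?sqr_i// (E (- 'i) (-1)) ?sqrrN ?sqr_i//.
rewrite !mul1r !mulN1r mulNr.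
have := parallelogram (a0 + b) (a1 * h); have := parallelogram (a0 - b) ('i * (a1 * h)).
have := parallelogram a0 b; have := sqr_ge0 (cmod (a1 * h)).
have := sqr_ge0 (cmod ('i * (a1 * h))); have := sqr_ge0 (cmod b).
lra.
Qed.

Lemma four_directions_id z h :
  \sum_(d <- [:: 1; 'i; -1; - 'i]) cmod (z + d * h) ^+ 2 =
  4 * cmod z ^+ 2 + 4 * cmod h ^+ 2.
Proof.
rewrite !big_cons big_nil addr0 !mulNr !mul1r.
have := parallelogram z h; have := parallelogram z ('i * h).
by rewrite [cmod ('i * h)]cmodM cmod_i mul1r; lra.
Qed.

(** Averaged over four directions at distance t, the quadratic part of q does not lower |q|^2, e
    |z|^2 gains e t^2, and the Taylor remainder costs at most M t^3, which is less for small t. *)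
Lemma no_local_max q z a e r : expands q z a -> 0 < e -> 0 < r ->
  (forall w, cmod (w - z) < r ->
     cmod (q w) ^+ 2 + e * cmod w ^+ 2 <= cmod (q z) ^+ 2 + e * cmod z ^+ 2) ->
  False.
Proof.
move=> qa e0 r0 qmax; have qz := expands_center qa.
case: qa => K [L [L0 Fa]]; have K0 := expands_with_ge0 Fa.
(* If u = K (L t)^3 bounds the remainder, replacing q by its quadratic part changes |q|^2 by at most
   2 |q| u + u^2 <= 3 K u = M t^3. *)
pose M := 3 * K ^+ 2 * L ^+ 3.
have M0 : 0 <= M by rewrite !mulr_ge0 ?exprn_ge0// ltW.
have [t [t0 tL tr tM]] : exists t, [/\ 0 < t, L * t <= 1, t < r & M * t < e].
  exists (Num.min (L^-1) (Num.min (r / 2) (e / (M + 1) / 2))).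
  have pos : 0 < e / (M + 1) by rewrite divr_gt0//; lra.
  set m := Num.min _ _.
  have m1 : m <= L^-1 by rewrite ge_min lexx.
  have m2 : m <= r / 2 by rewrite !ge_min lexx orbT.
  have m3 : m <= e / (M + 1) / 2 by rewrite !ge_min lexx !orbT.
  have m0 : 0 < m by rewrite !lt_min invr_gt0 L0 !divr_gt0//; lra.
  split=> //; first by rewrite -ler_pdivlMl// mulr1.
    by lra.
  have : (M + 1) * (e / (M + 1)) = e by rewrite mulrC divfK// gt_eqF//; lra.
  nra.
have dbound d : cmod d = 1 ->
    cmod (a 0%N + a 1%N * (d * t%:C) + a 2%N * (d * t%:C) ^+ 2) ^+ 2 + e * cmod (z + d * t%:C) ^+ 2
    <= cmod (a 0%N) ^+ 2 + e * cmod z ^+ 2 + M * t ^+ 3.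
  move=> cd; have dt : cmod (d * t%:C) = t.
    by rewrite cmodM cd mul1r cmod_real gtr0_norm.
  set h := d * _ in dt *.
  have hr : cmod (z + h - z) < r by rewrite [z + h]addrC addrK dt.
  have := qmax _ hr; rewrite qz => A1.
  have := Fa 0%N h; have := Fa 3%N h; rewrite dt tL => /(_ isT) A2 /(_ isT).
  rewrite big_ord0 subr0 expr0 mulr1 => A3.
  move: A2; rewrite !big_ord_recr big_ord0/= expr0 mulr1 add0r expr1.
  set p := a 0%N + _ + _; set u := K * _ => A2.
  have u0 : 0 <= u := le_trans (cmod_ge0 _) A2.
  have uK : u <= K by rewrite /u ler_piMr// exprn_ile1// mulr_ge0// ltW.
  have pq : cmod p <= cmod (q (z + h)) + u.
    have -> : p = q (z + h) - (q (z + h) - p) by rewrite subKr.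
    by apply: le_trans (cmodB _ _) _; rewrite lerD2l.
  have Mt : M * t ^+ 3 = 3 * K * u by rewrite /M /u; ring.
  rewrite Mt; move: (cmod_ge0 p) (cmod_ge0 (q (z + h))) pq A1 A3.
  move: (cmod p) (cmod (q _)) (e * _ ^+ 2) => P Q E P0 Q0 pq A1 A3.
  have : P ^+ 2 <= (Q + u) ^+ 2 by rewrite lerXn2r// ?nnegrE// addr_ge0.
  nra.
have : 4 * (cmod (a 0%N) ^+ 2 + e * cmod z ^+ 2 + e * t ^+ 2) <=
    4 * (cmod (a 0%N) ^+ 2 + e * cmod z ^+ 2 + M * t ^+ 3).
  have := four_directions (a 0%N) (a 1%N) (a 2%N) t%:C.
  have := four_directions_id z t%:C.
  have := dbound 1; have := dbound 'i; have := dbound (-1); have := dbound (- 'i).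
  rewrite !cmodN cmod1 cmod_i => /(_ erefl) B1 /(_ erefl) B2 /(_ erefl) B3 /(_ erefl) B4.
  rewrite !big_cons !big_nil !addr0 cmod_real real_normK ?num_real//; nra.
have := exprn_gt0 3 t0; have := exprn_gt0 2 t0.
rewrite [t ^+ 3]exprS; nra.
Qed.

Lemma rectangle_compact (M : R) :
  compact [set z : C | `|Re z| <= M /\ `|Im z| <= M].
Proof.
pose g (p : R * R) : C := p.1 +i* p.2.
have -> : [set z : C | `|Re z| <= M /\ `|Im z| <= M] =
    g @` (`[- M, M] `*` `[- M, M]).
  apply/seteqP; split=> [z [z1 z2]|_ [[x y] [/= x1 y1] <-]].
    exists (Re z, Im z); last by case: z z1 z2.
    by split; rewrite /= in_itv/= -ler_norml.
  by move: x1 y1; rewrite /= !in_itv/= -!ler_norml.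
apply: continuous_compact; last by apply: compact_setX; exact: segment_compact.
apply: continuous_subspaceT => p.
have Fp := nbhs_filter p.
apply/(@cvgCP R _ (nbhs p) Fp g (g p)) => e e0.
have e2 : 0 < e / 2 by lra.
have /cvgrPdistC_lt/(_ _ e2) c1 : fst @ p --> p.1 by exact: cvg_fst.
have /cvgrPdistC_lt/(_ _ e2) c2 : snd @ p --> p.2 by exact: cvg_snd.
near=> s.
have s1 : `|s.1 - p.1| < e / 2 by near: s.
have s2 : `|s.2 - p.2| < e / 2 by near: s.
have -> : g s - g p = (s.1 - p.1)%:C + 'i * (s.2 - p.2)%:C.
  by apply/eqP; rewrite eq_complex /g !ReImE /=; apply/andP; split; apply/eqP; ring.
apply: le_lt_trans (cmodD _ _) _.
by rewrite cmodM cmod_i mul1r !cmod_real; lra.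
Unshelve. all: by end_near. Qed.

Lemma cmod_continuous f z : {for z, continuous f} ->
  cmod (f w) @[w --> z] --> cmod (f z).
Proof. exact: (@cvg_cmod R _ (nbhs z) (nbhs_filter z) f (f z)). Qed.

(** The maximum of |q|^2 + e |z|^2 on the compact D is not at an interior point, hence is at most
    B^2 + e M^2; then e tends to 0. The sign of B comes along, to pass back from squares. *)
Lemma maximum_principle q (D : set C) (M B : R) :
  closed D -> (forall z, D z -> cmod z <= M) ->
  (forall z, D z -> exists a, expands q z a) ->
  (forall z, D z -> (\forall w \near z, D w) \/ cmod (q z) <= B) ->
  forall z, D z -> cmod (q z) <= B.
Proof.
move=> Dcl DM Dq DB z1 Dz1.
have cD : compact D.
  apply: subclosed_compact Dcl (@rectangle_compact M) _ => z Dz; split.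
    exact: le_trans (ler_Re_cmod _) (DM z Dz).
  exact: le_trans (ler_Im_cmod _) (DM z Dz).
have step e : 0 < e -> cmod (q z1) ^+ 2 <= B ^+ 2 + e * M ^+ 2 /\ 0 <= B.
  move=> e0.
  have [//|c|c cD0 cmax] := @compact_EVT_max _ R
    (fun z => cmod (q z) ^+ 2 + e * cmod z ^+ 2) D _ cD _.
  - by exists z1.
  - apply: continuous_in_subspaceT => z; rewrite inE => Dz.
    have [a za] := Dq z Dz; have qz := cmod_continuous (expands_continuous_center za).
    have iz := cmod_continuous (expands_continuous_center (expands_id z)).
    have -> : (fun w => cmod (q w) ^+ 2 + e * cmod w ^+ 2) =
        (fun w => cmod (q w) * cmod (q w) + e * (cmod w * cmod w)).
      by apply/funext => w; rewrite !expr2.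
    exact: cvgD (cvgM qz qz) (cvgMr (cvgM iz iz)).
  rewrite inE in cD0; have [a ca] := Dq c cD0.
  have [/nbhsCP[r r0 rP]|cB] := DB c cD0.
    exfalso; apply: (no_local_max ca e0 r0) => w wr.
    by apply: cmax; rewrite inE; exact: rP.
  have := cmax z1; rewrite inE => /(_ Dz1).
  have := DM c cD0; have := cmod_ge0 c; have := cmod_ge0 (q c).
  have := cmod_ge0 z1 => A0 A1 A2 A3 A4.
  have B0 : 0 <= B by lra.
  split=> //.
  have : cmod (q c) ^+ 2 <= B ^+ 2 by rewrite lerXn2r.
  have : cmod c ^+ 2 <= M ^+ 2 by rewrite lerXn2r// nnegrE; lra.
  have : 0 <= cmod z1 ^+ 2 by rewrite exprn_ge0.
  nra.
have [_ B0] := step 1 ltr01.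
rewrite -(@ler_pXn2r _ 2)// ?nnegrE ?cmod_ge0//.
apply/ler_addgt0Pr => e e0.
have e1 : 0 < e / (M ^+ 2 + 1) by rewrite divr_gt0// ltr_wpDl ?sqr_ge0.
have [A1 _] := step _ e1; apply: le_trans A1 _.
rewrite lerD2l mulrAC ler_pdivrMr ?ltr_wpDl ?sqr_ge0//.
by have := sqr_ge0 M; nra.
Qed.

End MaximumPrinciple.

(** * Schwarz-Pick inequality *)

Section SchwarzPick.
Local Open Scope complex_scope.
Local Open Scope classical_set_scope.
Variable R : realType.
Local Notation C := (R[i]^o).
Local Notation Re := (@complex.Re R).
Local Notation Im := (@complex.Im R).
Implicit Types (f : C -> C) (z w : C) (a : nat -> C) (r : R).

Lemma analytic_atP f z : analytic_at f z <-> exists a, expands f z a.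
Proof.
by split=> -[a fa]; exists a; [exact: series_expands|exact: expands_series].
Qed.

Lemma cmod_conjB_gt0 z w : 0 < Im z -> 0 < Im w -> 0 < cmod (z - (w^*)%C).
Proof.
move=> z0 w0; rewrite lt_neqAle cmod_ge0 andbT eq_sym -sqrf_eq0 cmod_conj_sqr.
have := sqr_ge0 (cmod (z - w)); have : 0 < 4 * Im z * Im w by rewrite !mulr_gt0.
by move=> ? ?; rewrite gt_eqF//; lra.
Qed.

(** Non-positive exactly on the pseudo-hyperbolic disc of centre z0 and radius r. Cleared of its
    denominator, the condition is Lipschitz on the whole plane, which gives closedness and interior
    points at once. *)
Definition pseudo_dist (z0 : C) (r : R) z := cmod (z - z0) - r * cmod (z - (z0^*)%C).

Section PseudoDisc.
Variables (z0 : C) (r : R).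
Hypotheses (z0_gt0 : 0 < Im z0) (r_gt0 : 0 < r) (r_lt1 : r < 1).
Local Notation pdist := (pseudo_dist z0 r).

Lemma pseudo_dist_lip z w : pdist w <= pdist z + 2 * cmod (w - z).
Proof.
rewrite /pseudo_dist.
have := cmodD (w - z) (z - z0); have -> : w - z + (z - z0) = w - z0 by ring.
have := cmodD (w - (z0^*)%C) (z - w); have -> : w - (z0^*)%C + (z - w) = z - (z0^*)%C by ring.
rewrite (cmod_distC z w) => A1 A2.
have A3 := ler_wpM2l (ltW r_gt0) A1.
have A4 : r * cmod (w - z) <= cmod (w - z) by rewrite ler_piMl ?cmod_ge0// ltW.
lra.
Qed.

Lemma pseudo_disc_closed : closed [set z | pdist z <= 0].
Proof.
rewrite -openC openE => z /= /negP; rewrite -ltNge => z1.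
apply/nbhsCP; exists (pdist z / 2) => [|w wz]; first by rewrite divr_gt0.
apply/negP; rewrite -ltNge.
by have := pseudo_dist_lip w z; rewrite cmod_distC; lra.
Qed.

Lemma pseudo_disc_interior z : pdist z < 0 -> \forall w \near z, pdist w <= 0.
Proof.
move=> z1; apply/nbhsCP; exists (- pdist z / 2) => [|w wz]; first by lra.
by have := pseudo_dist_lip z w; lra.
Qed.

Lemma pseudo_disc_bounded z : pdist z <= 0 ->
  cmod z <= cmod z0 + r * cmod (z0 - (z0^*)%C) / (1 - r).
Proof.
move=> z1; have -> : z = z0 + (z - z0) by ring.
apply: le_trans (cmodD _ _) _; rewrite lerD2l ler_pdivlMr ?subr_gt0//.
move: z1; rewrite /pseudo_dist.
have := cmodD (z - z0) (z0 - (z0^*)%C).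
have -> : z - z0 + (z0 - (z0^*)%C) = z - (z0^*)%C by ring.
move=> A1 A2; have := ler_wpM2l (ltW r_gt0) A1; nra.
Qed.

(** A point with Im z <= 0 is no farther from the conjugate of z0 than from z0, so with r < 1 it
    would have to be z0. *)
Lemma pseudo_disc_upper z : pdist z <= 0 -> 0 < Im z.
Proof.
rewrite /pseudo_dist => z1; rewrite ltNge; apply/negP => zi.
have := cmod_conj_sqr z z0; have := cmod_ge0 (z - z0).
have := cmod_ge0 (z - (z0^*)%C) => A1 A2 A3.
have Iz : Im z * Im z0 <= 0 by rewrite mulr_le0_ge0// ltW.
have A4 : cmod (z - (z0^*)%C) <= cmod (z - z0).
  by rewrite -(@ler_pXn2r _ 2)// A3 -mulrA; lra.
have A5 : cmod (z - z0) = 0.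
  have r1 : 0 < 1 - r by rewrite subr_gt0.
  apply/eqP; rewrite eq_le A2 andbT -(pmulr_rle0 _ r1).
  by have := ler_wpM2l (ltW r_gt0) A4; lra.
have : z == z0 by rewrite -subr_eq0 -cmod_eq0 A5.
by move=> /eqP E; move: zi; rewrite E leNgt z0_gt0.
Qed.

End PseudoDisc.

(* The maximum principle is applied to q = psi / phi, with phi and psi the
   Cayley quotients of z and f z, on the pseudo-discs |phi| <= r as r -> 1. *)
Lemma schwarz_pick_pos f (z0 z : C) :
  (forall w, 0 < Im w -> exists a, expands f w a) ->
  (forall w, 0 < Im w -> 0 < Im (f w)) -> 0 < Im z0 -> 0 < Im z ->
  Im z * Im z0 * cmod (f z - f z0) ^+ 2 <=
  Im (f z) * Im (f z0) * cmod (z - z0) ^+ 2.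
Proof.
move=> fA fI z00 z_gt0.
have [->|zz0] := eqVneq z z0; first by rewrite !subrr cmod0 expr0n/= !mulr0.
pose psi w : C := (f w - f z0) * (f w - ((f z0)^*)%C)^-1.
have psi1 w : 0 < Im w -> cmod (psi w) <= 1.
  move=> w0; rewrite cmodM cmodV ler_pdivrMr ?cmod_conjB_gt0 ?fI// mul1r.
  rewrite -(@ler_pXn2r _ 2)// ?nnegrE ?cmod_ge0// cmod_conj_sqr lerDl.
  by rewrite !mulr_ge0// ltW// fI.
have psiA w : 0 < Im w -> exists a, expands psi w a.
  move=> w0; have [a wa] := fA w w0.
  have D c := expandsD wa (expands_cst c w).
  have := expandsV _ (D (- ((f z0)^*)%C)); case=> [|b [wb _ _]].
    by rewrite -(expands_center (D _)) -cmod_gt0 cmod_conjB_gt0// fI.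
  by eexists; exact: expandsM (D (- f z0)) wb.
have [a z0a] := psiA z0 z00.
have a0 : a 0%N = 0 by rewrite -(expands_center z0a) /psi subrr mul0r.
(* The zero of psi at z0 cancels that of phi, so this q is analytic on the half-plane. *)
pose q w : C := (if w == z0 then a 1%N else psi w / (w - z0)) * (w - (z0^*)%C).
have qE w : w != z0 -> q w = psi w / (w - z0) * (w - (z0^*)%C).
  by move=> wz0; rewrite /q (negbTE wz0).
have qA w : 0 < Im w -> exists b, expands q w b.
  move=> w0; have Dw c := expandsD (expands_id w) (expands_cst c w).
  have [->|wz0] := eqVneq w z0.
    by eexists; exact: expandsM (expands_divX a0 z0a) (expandsD (expands_id z0) (expands_cst _ z0)).
  have [b wb] := psiA w w0.
  have [|c [wc _ _]] := expandsV _ (Dw (- z0)).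
    by rewrite -(expands_center (Dw _)) subr_eq0.
  eexists; apply: expands_near (expandsM (expandsM wb wc) (Dw (- (z0^*)%C))) _.
  apply/nbhsCP; exists (cmod (w - z0)) => [|u uw]; first by rewrite cmod_gt0 subr_eq0.
  by apply: qE; apply: contraTneq uw => ->; rewrite cmod_distC ltxx.
have cz0 := cmod_conjB_gt0 z_gt0 z00.
have czz0 : 0 < cmod (z - z0) by rewrite cmod_gt0 subr_eq0.
have czlt : cmod (z - z0) < cmod (z - (z0^*)%C).
  rewrite -(@ltr_pXn2r _ 2)// ?nnegrE ?cmod_ge0// cmod_conj_sqr ltrDl.
  by rewrite !mulr_gt0.
(* Such an r puts z in the pseudo-disc, on whose edge |phi| = r and |psi| <= 1 give |q| <= 1 / r. *)
have qr r : cmod (z - z0) / cmod (z - (z0^*)%C) <= r -> r < 1 -> cmod (q z) <= r^-1.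
  move=> zr r1; have r0 : 0 < r by apply: lt_le_trans zr; rewrite divr_gt0.
  apply: (maximum_principle (pseudo_disc_closed r0 r1) (pseudo_disc_bounded r0 r1)).
  - by move=> w /(pseudo_disc_upper z00 r0 r1); exact: qA.
  - move=> w /= wr; have w0 := pseudo_disc_upper z00 r0 r1 wr.
    move: wr; rewrite le_eqVlt => /orP[/eqP wr|wr]; last first.
      by left; exact: pseudo_disc_interior.
    right; have wz0 := cmod_conjB_gt0 w0 z00.
    have wE : cmod (w - z0) = r * cmod (w - (z0^*)%C) by move: wr; rewrite /pseudo_dist; lra.
    have cw : 0 < cmod (w - z0) by rewrite wE mulr_gt0.
    rewrite qE; last by rewrite -subr_eq0 -cmod_gt0.
    rewrite [cmod (_ * _)]cmodM [cmod (psi w / _)]cmodM [cmod (w - z0)^-1]cmodV.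
    rewrite wE invfM -mulrA -mulrA mulVf ?gt_eqF// mulr1.
    by rewrite ler_piMl// ?psi1// invr_ge0 ltW.
  by move: zr; rewrite ler_pdivrMr// /= /pseudo_dist subr_le0.
have q1 : cmod (q z) <= 1.
  rewrite leNgt; apply/negP => q1.
  have iq : (cmod (q z))^-1 < 1 by rewrite invf_lt1//; lra.
  (* A radius below 1, admissible for z, and above 1 / |q z|; it contradicts |q z| <= 1 / r. *)
  set r := Num.max (cmod (z - z0) / cmod (z - (z0^*)%C)) ((1 + (cmod (q z))^-1) / 2).
  have r1 : r < 1 by rewrite gt_max ltr_pdivrMr// mul1r czlt/=; lra.
  have rq : (cmod (q z))^-1 < r by rewrite lt_max; apply/orP; right; lra.
  have := qr r; rewrite le_max lexx => /(_ isT r1).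
  rewrite leNgt => /negP; apply.
  have q0 : 0 < cmod (q z) by lra.
  by rewrite -[X in _ < X]invrK ltf_pV2// posrE ?invr_gt0// (lt_trans _ rq)// invr_gt0.
have cf := cmod_conjB_gt0 (fI z z_gt0) (fI z0 z00).
have key : cmod (f z - f z0) * cmod (z - (z0^*)%C) <= cmod (z - z0) * cmod (f z - ((f z0)^*)%C).
  move: q1; rewrite qE// !cmodM !cmodV mulrAC ler_pdivrMr// mul1r mulrAC ler_pdivrMr//.
have {}key : (cmod (f z - f z0) * cmod (z - (z0^*)%C)) ^+ 2 <=
    (cmod (z - z0) * cmod (f z - ((f z0)^*)%C)) ^+ 2.
  by rewrite lerXn2r// nnegrE mulr_ge0 ?cmod_ge0.
by move: key; rewrite !exprMn !cmod_conj_sqr; lra.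
Qed.

(** Adding i e to f makes its imaginary part positive without changing differences; then e tends to
    0. *)
Lemma schwarz_pick f (z0 z : C) : pick_class f -> 0 < Im z0 -> 0 < Im z ->
  Im z * Im z0 * cmod (f z - f z0) ^+ 2 <=
  Im (f z) * Im (f z0) * cmod (z - z0) ^+ 2.
Proof.
move=> [fA fI] z00 z_gt0.
have A1 := fI z z_gt0; have A2 := fI z0 z00.
have step e : 0 < e -> Im z * Im z0 * cmod (f z - f z0) ^+ 2 <=
  (Im (f z) + e) * (Im (f z0) + e) * cmod (z - z0) ^+ 2.
  move=> e0; pose fe w : C := f w + 'i * e%:C.
  have := @schwarz_pick_pos fe z0 z; rewrite /fe !ReImE /=.
  have -> : f z + 'i * e%:C - (f z0 + 'i * e%:C) = f z - f z0 by ring.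
  rewrite !mul0r !mul1r add0r; apply=> // w w0.
    have /analytic_atP[a wa] := fA w w0.
    by eexists; exact: expandsD wa (expands_cst _ w).
  have := fI w w0; rewrite !ReImE /=; lra.
set N := cmod (z - z0) ^+ 2 in step *; have N0 : 0 <= N by exact: sqr_ge0.
set P := (X in X <= _) in step *.
set u := Im (f z) in step A1 *; set v := Im (f z0) in step A2 *.
apply/ler_addgt0Pr => d d0.
(* With e <= 1 the excess (u + v) e N + e^2 N is at most e (u + v + 1) N, hence at most d. *)
pose e := Num.min 1 (d / ((u + v + 1) * N + 1)).
have D0 : 0 < (u + v + 1) * N + 1 by rewrite ltr_wpDl// mulr_ge0//; lra.
have e0 : 0 < e by rewrite lt_min ltr01 divr_gt0.
have e1 : e <= 1 by rewrite ge_min lexx.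
have ed : e * ((u + v + 1) * N + 1) <= d by rewrite -ler_pdivlMr// ge_min lexx orbT.
have A3 := step e e0; have A4 : e * e * N <= e * N by rewrite ler_wpM2r// ger_pMl.
have -> : u * v * N + d = (u + e) * (v + e) * N + (d - (u + v) * e * N - e * e * N) by ring.
apply: le_trans A3 _; rewrite lerDl; lra.
Qed.

End SchwarzPick.

(** * Boundary limits and Julia's inequality *)

Section Boundary.
Local Open Scope complex_scope.
Local Open Scope classical_set_scope.
Variable R : realType.
Local Notation C := (R[i]^o).
Local Notation Re := (@complex.Re R).
Local Notation Im := (@complex.Im R).
Implicit Types (f F G : C -> C) (z w c d : C) (a : nat -> C) (r x : R).

Definition vertical x (t : R) : C := x%:C + 'i * t%:C.

Lemma Im_vertical x t : Im (vertical x t) = t.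
Proof. by rewrite /vertical !ReImE /=; ring. Qed.

Lemma vertical_upper x t : 0 < t -> upper_half_plane (vertical x t).
Proof. by rewrite /upper_half_plane /mkset Im_vertical. Qed.

Lemma cmod_verticalB x t : cmod (vertical x t - x%:C) = `|t|.
Proof. by rewrite /vertical addrC addKr cmodM cmod_i mul1r cmod_real. Qed.

Lemma vertical_near x (P : C -> Prop) : (\forall z \near (x%:C : C), P z) ->
  \forall t \near 0^'+, P (vertical x t).
Proof.
move=> /nbhsCP[e e0 eP]; near=> t; apply: eP; by rewrite cmod_verticalB gtr0_norm.
Unshelve. all: by end_near. Qed.

Lemma vertical_neq x t : 0 < t -> vertical x t != x%:C.
Proof. by move=> t0; rewrite -subr_eq0 -cmod_eq0 cmod_verticalB normr_eq0 gt_eqF. Qed.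

Lemma vertical_cvg x F : {for (x%:C : C), continuous F} ->
  F (vertical x t) @[t --> 0^'+] --> F x%:C.
Proof.
move=> /continuousCP Fx; apply/cvgCP => e e0.
apply: (@vertical_near x (fun z => cmod (F z - F x%:C) < e)); apply/nbhsCP.
by have [r r0 rP] := Fx e e0; exists r.
Qed.

Lemma boundary_value_cvg f x c d : boundary_value f x c d ->
  f (vertical x t) @[t --> 0^'+] --> c.
Proof.
move=> [F [[FA Ff] <- _]].
have /analytic_atP[a /expands_continuous_center/vertical_cvg] := nbhs_singleton FA.
apply: cvg_trans; apply: near_eq_cvg.
near=> t; have t0 : 0 < t by [].
have : upper_half_plane (vertical x t) -> F (vertical x t) = f (vertical x t).
  by near: t; exact: vertical_near Ff.
by apply; exact: vertical_upper.
Unshelve. all: by end_near. Qed.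

Lemma boundary_value_slope f x c d : boundary_value f x c d ->
  (f (vertical x t) - c) / t%:C @[t --> 0^'+] --> d * 'i.
Proof.
move=> [F [[FA Ff] <- /is_deriveCP dF]].
apply/cvgCP => e e0; have e2 : 0 < e / 2 by lra.
have [r r0 rP] := dF _ e2; near=> t; have t0 : 0 < t by [].
have <- : F (vertical x t) = f (vertical x t).
  have : upper_half_plane (vertical x t) -> F (vertical x t) = f (vertical x t).
    by near: t; exact: vertical_near Ff.
  by apply; exact: vertical_upper.
have ct : cmod ('i * t%:C : C) = t by rewrite cmodM cmod_i mul1r cmod_real gtr0_norm.
have := rP ('i * t%:C); rewrite ct -/(vertical x t) => /(_ _) A1.
have {}A1 : cmod (F (vertical x t) - F x%:C - d * ('i * t%:C)) <= e / 2 * t.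
  by apply: A1; near: t; exact: nbhs_right_lt.
have tC : (t%:C : C) != 0 by rewrite -cmod_gt0 cmod_real gtr0_norm.
have -> : (F (vertical x t) - F x%:C) / t%:C - d * 'i =
  (F (vertical x t) - F x%:C - d * ('i * t%:C)) / t%:C.
  by rewrite [in RHS]mulrBl -!mulrA divff// mulr1.
rewrite cmodM cmodV cmod_real gtr0_norm// ltr_pdivrMr//.
by apply: le_lt_trans A1 _; rewrite ltr_pM2r//; lra.
Unshelve. all: by end_near. Qed.

(** The real value c has no imaginary part, and a step it along the vertical turns the slope d into
    d i. *)
Lemma boundary_value_Im f x (c d : R) : boundary_value f x c%:C d%:C ->
  Im (f (vertical x t)) / t @[t --> 0^'+] --> d.
Proof.
move=> /boundary_value_slope/cvg_Im; rewrite cImM /= mul0r addr0 mulr1.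
apply: cvg_trans; apply: near_eq_cvg.
near=> t; have t0 : 0 < t by [].
rewrite -fmorphV /= cImM cImD cImN /=; ring.
Unshelve. all: by end_near. Qed.

(** Different extensions agree with f on the vertical, and the limits there give both c and d. *)
Lemma boundary_value_unique f x c c' d d' :
  boundary_value f x c d -> boundary_value f x c' d' -> c = c' /\ d = d'.
Proof.
move=> B1 B2; have cc : c = c'.
  exact: (cvg_unique (@norm_hausdorff _ C) (boundary_value_cvg B1) (boundary_value_cvg B2)).
split=> //; rewrite -{}cc in B2.
have i0 : ('i : C) != 0 by rewrite -cmod_gt0 cmod_i.
apply: (mulIf i0).
exact: (cvg_unique (@norm_hausdorff _ C) (boundary_value_slope B1) (boundary_value_slope B2)).
Qed.

Lemma has_pole_expands F z k (r : C) : has_pole F z k r ->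
  exists a, [/\ (0 < k)%N, a 0%N != 0, a k.-1 = r &
    expands (fun w => if w == z then a 0%N else F w * (w - z) ^+ k) z a].
Proof.
move=> [k0 [a [a0 ar /dnbhsCP[e e0 aF]]]]; exists a; split=> //.
apply: series_expands; apply/nbhsCP; exists e => // w wz.
case: eqVneq => [->|wz0]; last exact: aF.
rewrite subrr; apply/cvgCP => d d0; exists 1%N => // -[//|n] _ /=.
rewrite /series/= big_nat_recl//= expr0 mulr1 big1 => [|i _]; last first.
  by rewrite exprS mul0r mulr0.
by rewrite addr0 subrr cmod0.
Qed.

Lemma expands_has_pole F G z a : a 0%N != 0 -> expands G z a ->
  (\forall w \near z^', F w = G w / (w - z)) -> has_pole F z 1 (a 0%N).
Proof.
move=> a0 /expands_series/nbhsCP[e e0 ha] /dnbhsCP[e' e'0 Fh]; split=> //.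
exists a; split=> //; apply/dnbhsCP; exists (Num.min e e').
  by rewrite lt_min e0.
move=> w; rewrite lt_min => /andP[we we'] wz.
by rewrite Fh// expr1 divfK ?subr_eq0//; exact: ha.
Qed.

(** The limit is the leading Laurent coefficient, never 0; it is the residue only for a simple
    pole. *)
Lemma boundary_pole_cvg f x k (r : C) : boundary_pole f x k r ->
  exists2 c, (0 < k)%N /\ c != 0 & (k = 1%N -> c = r) /\
    f (vertical x t) * ('i * t%:C) ^+ k @[t --> 0^'+] --> c.
Proof.
move=> [F [[_ Ff] /has_pole_expands[a [k0 a0 ak /expands_continuous_center/vertical_cvg]]]].
rewrite eqxx => Fa; exists (a 0%N) => //; split=> [k1|]; first by rewrite -ak k1.
apply: cvg_trans Fa; apply: near_eq_cvg.
near=> t; have t0 : 0 < t by [].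
rewrite (negbTE (vertical_neq _ t0)).
have -> : vertical x t - x%:C = 'i * t%:C by rewrite /vertical addrC addKr.
congr (_ * _).
have : upper_half_plane (vertical x t) -> F (vertical x t) = f (vertical x t).
  by near: t; exact: vertical_near Ff.
by apply; exact: vertical_upper.
Unshelve. all: by end_near. Qed.

Lemma vertical_it_cvg : ('i * t%:C : C) @[t --> 0^'+] --> (0 : C).
Proof.
apply/cvgCP => e e0; near=> t.
by rewrite subr0 cmodM cmod_i mul1r cmod_real gtr0_norm.
Unshelve. all: by end_near. Qed.

(** Surplus factors it kill a finite limit. Hence f cannot have a non-zero limit at two different
    orders of growth, order 0 being a finite value. *)
Lemma vertical_cvg0 (u : R -> C) (b : C) k m :
  u t * ('i * t%:C) ^+ k @[t --> 0^'+] --> b ->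
  u t * ('i * t%:C) ^+ (k + m).+1 @[t --> 0^'+] --> (0 : C).
Proof.
have step l (c : C) : u t * ('i * t%:C) ^+ l @[t --> 0^'+] --> c ->
    u t * ('i * t%:C) ^+ l.+1 @[t --> 0^'+] --> (0 : C).
  move=> uc; have -> : (fun t => u t * ('i * t%:C : C) ^+ l.+1) =
      (fun t => (u t * ('i * t%:C) ^+ l) * ('i * t%:C)).
    by apply/funext => t; rewrite exprSr mulrA.
  have cz : c * (0 : C) = 0 by rewrite mulr0.
  by rewrite -[X in _ --> X]cz; apply: cvgM uc _; exact: vertical_it_cvg.
move=> ub; elim: m => [|m IH]; first by rewrite addn0; exact: step ub.
by rewrite addnS; exact: step IH.
Qed.

Lemma boundary_pole_value_absurd f x k (r : C) c d :
  boundary_pole f x k r -> boundary_value f x c d -> False.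
Proof.
move=> /boundary_pole_cvg[a [k0 a0] [_ fa]] /boundary_value_cvg fc.
case: k k0 fa => [//|k _] fa.
have {}fc : f (vertical x t) * ('i * t%:C) ^+ 0 @[t --> 0^'+] --> c.
  apply: cvg_trans fc; apply: near_eq_cvg; near=> t.
  by rewrite expr0 mulr1.
have step := vertical_cvg0 k fc.
have a00 := cvg_unique (@norm_hausdorff _ C) fa step.
by rewrite a00 eqxx in a0.
Unshelve. all: by end_near. Qed.

Lemma boundary_pole_order f x k (r s : C) : s != 0 ->
  boundary_pole f x k r -> boundary_pole f x 1%N s -> r = s.
Proof.
move=> s0 /boundary_pole_cvg[a [k0 a0] [ar fa]] /boundary_pole_cvg[b [_ b0] [/(_ erefl) bs fb]].
case: k k0 fa ar => [//|[|k]] _ fa ar.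
  by rewrite -bs -(ar erefl) (cvg_unique (@norm_hausdorff _ C) fa fb).
have step := vertical_cvg0 k fb.
have a00 := cvg_unique (@norm_hausdorff _ C) fa step.
by rewrite a00 eqxx in a0.
Qed.

Lemma boundary_pole_cvg1 f x (s : R) : boundary_pole f x 1%N s%:C ->
  f (vertical x t) * t%:C @[t --> 0^'+] --> ((- s)%:C * 'i : C).
Proof.
move=> /boundary_pole_cvg[b _ [/(_ erefl) -> fb]].
have -> : (- s)%:C * 'i = (- 'i) * (s%:C : C).
  by rewrite rmorphN/= mulNr mulrC mulNr.
have : (- 'i) * (f (vertical x t) * ('i * t%:C) ^+ 1) @[t --> 0^'+] --> (- 'i) * (s%:C : C).
  exact: cvgMr.
apply: cvg_trans; apply: near_eq_cvg; near=> t.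
set u := f _; rewrite expr1.
have -> : - 'i * (u * ('i * t%:C)) = - ('i ^+ 2) * (u * t%:C) by ring.
by rewrite sqr_i opprK mul1r.
Unshelve. all: by end_near. Qed.

(** The common shape of all the limits below: B is the imaginary part at the moving point, divided
    by t at a finite value and multiplied by t at a pole. *)
Lemma ler_limit (k l : R) (A B S : R -> R) (a b s : R) :
  A t @[t --> 0^'+] --> a -> B t @[t --> 0^'+] --> b -> S t @[t --> 0^'+] --> s ->
  (\forall t \near 0^'+, k * A t ^+ 2 <= l * B t * S t ^+ 2) ->
  k * a ^+ 2 <= l * b * s ^+ 2.
Proof.
move=> Aa Bb Ss; rewrite !expr2 => kl.
have A1 : k * (A t * A t) @[t --> 0^'+] --> k * (a * a).
  by apply: cvgMr; exact: cvgM.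
have A2 : l * B t * (S t * S t) @[t --> 0^'+] --> l * b * (s * s).
  by apply: cvgM; [exact: cvgMr|exact: cvgM].
exact: ler_cvg_to A1 A2 kl.
Qed.

(** Schwarz-Pick at z and x + it, divided by t = Im (x + it). *)
Lemma julia_value f x (c d : R) z : pick_class f ->
  boundary_value f x c%:C d%:C -> 0 < Im z ->
  Im z * cmod (f z - c%:C) ^+ 2 <= Im (f z) * d * cmod (z - x%:C) ^+ 2.
Proof.
move=> fP fx z0.
have vx : vertical x t @[t --> 0^'+] --> (x%:C : C).
  exact: vertical_cvg (expands_continuous_center (expands_id _)).
have A1 : cmod (f z - f (vertical x t)) @[t --> 0^'+] --> cmod (f z - c%:C).
  exact: cvg_cmod (cvgB (cvg_cst (f z)) (boundary_value_cvg fx)).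
have A2 : cmod (z - vertical x t) @[t --> 0^'+] --> cmod (z - x%:C).
  exact: cvg_cmod (cvgB (cvg_cst z) vx).
apply: (ler_limit A1 (boundary_value_Im fx) A2).
near=> t; have t0 : 0 < t by [].
have := @schwarz_pick R f (vertical x t) z fP; rewrite Im_vertical => /(_ t0 z0) SP.
rewrite -(ler_pM2r t0) [X in X <= _]mulrAC; apply: le_trans SP _.
have -> : Im (f z) * (Im (f (vertical x t)) / t) * cmod (z - vertical x t) ^+ 2 * t =
  (Im (f z) * Im (f (vertical x t)) * cmod (z - vertical x t) ^+ 2) * (t / t) by ring.
by rewrite divff ?mulr1// gt_eqF.
Unshelve. all: by end_near. Qed.

(** Here f(x + it) blows up, so Schwarz-Pick is multiplied by t: t f(x + it) tends to -s i while t
    f(z) tends to 0. *)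
Lemma julia_pole f x (s : R) z : pick_class f ->
  boundary_pole f x 1%N s%:C -> 0 < Im z ->
  Im z * s ^+ 2 <= Im (f z) * - s * cmod (z - x%:C) ^+ 2.
Proof.
move=> fP fx z0.
have vx : vertical x t @[t --> 0^'+] --> (x%:C : C).
  exact: vertical_cvg (expands_continuous_center (expands_id _)).
pose p : C := (- s)%:C * 'i.
have tf : f (vertical x t) * t%:C @[t --> 0^'+] --> p := boundary_pole_cvg1 fx.
have tz : f z * t%:C @[t --> 0^'+] --> (0 : C).
  apply/cvgCP => e e0; near=> t; rewrite subr0 cmodM cmod_real gtr0_norm//.
  have t1 : t < e / (cmod (f z) + 1).
    by near: t; apply: nbhs_right_lt; rewrite divr_gt0// ltr_wpDl ?cmod_ge0.
  move: t1; rewrite ltr_pdivlMr ?ltr_wpDl ?cmod_ge0//; apply: le_lt_trans.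
  by rewrite mulrDr mulr1 [leLHS]mulrC lerDl.
have Is : Im p = - s by rewrite /p cImM /=; ring.
have cs : s ^+ 2 = cmod (0 - p) ^+ 2.
  by rewrite /p sub0r cmodN cmod_sqr !ReImE /=; ring.
rewrite cs -[X in _ * X * _]Is.
have A1 : cmod (f z * t%:C - f (vertical x t) * t%:C) @[t --> 0^'+] --> cmod (0 - p).
  by apply: cvg_cmod; exact: cvgB tz tf.
have A2 : cmod (z - vertical x t) @[t --> 0^'+] --> cmod (z - x%:C).
  exact: cvg_cmod (cvgB (cvg_cst z) vx).
apply: (ler_limit A1 (cvg_Im tf) A2).
near=> t; have t0 : 0 < t by [].
have := @schwarz_pick R f (vertical x t) z fP; rewrite Im_vertical => /(_ t0 z0) SP.
rewrite -mulrBl cmodM cmod_real gtr0_norm// cImM /= mulr0 add0r.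
have := ler_wpM2r (ltW t0) SP.
set A := cmod _; set B := cmod _; set D := Im (f z); set E := Im _.
have -> : Im z * t * A ^+ 2 * t = Im z * (A * t) ^+ 2 by ring.
by move=> /le_trans; apply; rewrite le_eqVlt; apply/orP; left; apply/eqP; ring.
Unshelve. all: by end_near. Qed.

End Boundary.

(** * Inequalities between two boundary nodes, and rigidity *)

Section TwoPoints.
Local Open Scope complex_scope.
Local Open Scope classical_set_scope.
Variable R : realType.
Local Notation C := (R[i]^o).
Local Notation Re := (@complex.Re R).
Local Notation Im := (@complex.Im R).
Implicit Types (f : C -> C) (z w : C) (x y c d s : R).

Lemma cmod_vertical_cvg x y :
  cmod (vertical y t - (x%:C : C)) @[t --> 0^'+] --> `|y - x|.
Proof.
rewrite -cmod_real rmorphB/=.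
have vy : vertical y t @[t --> 0^'+] --> (y%:C : C).
  exact: vertical_cvg (expands_continuous_center (expands_id _)).
exact: cvg_cmod (cvgB vy (cvg_cst (x%:C : C))).
Qed.

(** Julia's inequality at y + it, divided by t. This is the non-negativity of the 2 by 2 Pick
    determinant. *)
Lemma pick_value_value f x c d y c' d' : pick_class f ->
  boundary_value f x c%:C d%:C -> boundary_value f y c'%:C d'%:C ->
  (c' - c) ^+ 2 <= d' * d * (y - x) ^+ 2.
Proof.
move=> fP fx fy.
have A1 : cmod (f (vertical y t) - c%:C) @[t --> 0^'+] --> `|c' - c|.
  rewrite -cmod_real rmorphB/=.
  exact: cvg_cmod (cvgB (boundary_value_cvg fy) (cvg_cst (c%:C : C))).
have := ler_limit (k := 1) (l := d) A1 (boundary_value_Im fy) (@cmod_vertical_cvg x y).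
rewrite !real_normK ?num_real// mul1r [d * d']mulrC; apply.
near=> t; have t0 : 0 < t by [].
have := @julia_value R f x c d (vertical y t) fP fx; rewrite Im_vertical => /(_ t0) J.
rewrite -(ler_pM2l t0) mul1r; apply: le_trans J _.
have -> : t * (d * (Im (f (vertical y t)) / t) * cmod (vertical y t - x%:C) ^+ 2) =
  (Im (f (vertical y t)) * d * cmod (vertical y t - x%:C) ^+ 2) * (t / t) by ring.
by rewrite divff ?mulr1// gt_eqF.
Unshelve. all: by end_near. Qed.

(** Julia's inequality at y + it, multiplied by t. With s = -1/v it reads 1 <= v d (y - x)^2, again
    a Pick determinant. *)
Lemma pick_value_pole f x c d y s : pick_class f ->
  boundary_value f x c%:C d%:C -> boundary_pole f y 1%N s%:C ->
  s ^+ 2 <= - s * d * (y - x) ^+ 2.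
Proof.
move=> fP fx fy.
pose p : C := (- s)%:C * 'i.
have E : s ^+ 2 = cmod (p - 0) ^+ 2.
  by rewrite /p subr0 cmod_sqr !ReImE /=; ring.
have Is : Im p = - s by rewrite /p cImM /=; ring.
have tc : (c%:C : C) * t%:C @[t --> 0^'+] --> (0 : C).
  apply/cvgCP => e e0; near=> t; rewrite subr0 cmodM !cmod_real [X in _ * X]gtr0_norm//.
  have t1 : t < e / (`|c| + 1) by near: t; apply: nbhs_right_lt; rewrite divr_gt0// ltr_wpDl.
  move: t1; rewrite ltr_pdivlMr ?ltr_wpDl//; apply: le_lt_trans.
  by rewrite mulrDr mulr1 [leLHS]mulrC lerDl.
have tf : f (vertical y t) * t%:C @[t --> 0^'+] --> p := boundary_pole_cvg1 fy.
have A1 : cmod (f (vertical y t) * t%:C - (c%:C : C) * t%:C) @[t --> 0^'+] --> cmod (p - 0).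
  by apply: cvg_cmod; exact: cvgB tf tc.
have := ler_limit (k := 1) (l := d) A1 (cvg_Im tf) (@cmod_vertical_cvg x y).
rewrite real_normK ?num_real// mul1r Is -E [d * - s]mulrC; apply.
near=> t; have t0 : 0 < t by [].
have := @julia_value R f x c d (vertical y t) fP fx; rewrite Im_vertical => /(_ t0) J.
have := ler_wpM2l (ltW t0) J.
rewrite -mulrBl cmodM cmod_real gtr0_norm// cImM /= mulr0 add0r mul1r.
set A := cmod _; set B := cmod _; set I := Im _.
have -> : t * (t * A ^+ 2) = (A * t) ^+ 2 by ring.
by move=> /le_trans; apply; rewrite le_eqVlt; apply/orP; left; apply/eqP; ring.
Unshelve. all: by end_near. Qed.

(** Schwarz-Pick with Im (f z) = 0 leaves no room for f w to differ from f z; this replaces the open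
    mapping theorem. *)
Lemma pick_Im_eq0 f z w : pick_class f -> upper_half_plane z ->
  Im (f z) = 0 -> upper_half_plane w -> f w = f z.
Proof.
move=> fP z0 fz0 w0; apply/eqP; rewrite -subr_eq0 -cmod_eq0 -sqrf_eq0.
have := schwarz_pick fP z0 w0; rewrite fz0 mulr0 mul0r pmulr_rle0 ?mulr_gt0// => A.
by rewrite eq_le A sqr_ge0.
Qed.

Lemma boundary_value_cst f x c d (k : C) : boundary_value f x c%:C d%:C ->
  (forall z, upper_half_plane z -> f z = k) -> d = 0.
Proof.
move=> fx fk.
have A : f (vertical x t) @[t --> 0^'+] --> k.
  apply: cvg_near_cst; near=> t.
  by rewrite fk//; exact: vertical_upper.
have kc := cvg_unique (@norm_hausdorff _ C) A (boundary_value_cvg fx).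
have B : Im (f (vertical x t)) / t @[t --> 0^'+] --> (0 : R).
  apply: cvg_near_cst; near=> t.
  by rewrite fk ?kc /= ?mul0r//; exact: vertical_upper.
exact: (cvg_unique (@norm_hausdorff R R^o) (boundary_value_Im fx) B).
Unshelve. all: by end_near. Qed.

(** Slope 0 at y makes f constant by Julia's inequality, and then the slope at x is 0 too. This
    supplies v_j > 0 when w_j = w_1 becomes a pole of the reduction. *)
Lemma pick_slope_gt0 f x c d y c' d' : pick_class f -> 0 < d ->
  boundary_value f x c%:C d%:C -> boundary_value f y c'%:C d'%:C -> 0 <= d' ->
  0 < d'.
Proof.
move=> fP d0 fx fy; rewrite le_eqVlt => /orP[/eqP d'0|//]; exfalso.
move: d0; rewrite (@boundary_value_cst f x c d c'%:C fx) ?ltxx// => z z0.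
have := julia_value fP fy z0; rewrite -d'0 mulr0 mul0r pmulr_rle0// => A.
by apply/eqP; rewrite -subr_eq0 -cmod_eq0 -sqrf_eq0 eq_le A sqr_ge0.
Qed.

End TwoPoints.

(** * Analytic and meromorphic functions *)

Section Analytic.
Local Open Scope complex_scope.
Local Open Scope classical_set_scope.
Variable R : realType.
Local Notation C := (R[i]^o).
Implicit Types (F G : C -> C) (z w : C).

Lemma analytic_near F G z : analytic_at F z ->
  (\forall w \near z, G w = F w) -> analytic_at G z.
Proof. by move=> /analytic_atP[a Fa] GF; apply/analytic_atP; exists a; exact: expands_near GF. Qed.

Lemma analytic_ext F G z : (forall w, G w = F w) -> analytic_at F z -> analytic_at G z.
Proof. by move=> /funext ->. Qed.

Lemma analytic_continuous F z : analytic_at F z -> {for z, continuous F}.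
Proof. by move=> /analytic_atP[a /expands_continuous_center]. Qed.

Lemma analytic_cst (c : C) z : analytic_at (fun=> c) z.
Proof. by apply/analytic_atP; eexists; exact: expands_cst. Qed.

Lemma analyticD F G z : analytic_at F z -> analytic_at G z ->
  analytic_at (fun w => F w + G w) z.
Proof.
move=> /analytic_atP[a Fa] /analytic_atP[b Gb]; apply/analytic_atP.
by eexists; exact: expandsD Fa Gb.
Qed.

Lemma analyticM F G z : analytic_at F z -> analytic_at G z ->
  analytic_at (fun w => F w * G w) z.
Proof.
move=> /analytic_atP[a Fa] /analytic_atP[b Gb]; apply/analytic_atP.
by eexists; exact: expandsM Fa Gb.
Qed.

Lemma analyticV F z : analytic_at F z -> F z != 0 -> analytic_at (fun w => (F w)^-1) z.
Proof.
move=> /analytic_atP[a Fa] Fz; apply/analytic_atP.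
have [|b [Fb _ _]] := expandsV _ Fa; first by rewrite -(expands_center Fa).
by exists b.
Qed.

Lemma expands_subX (c : C) z : expands (fun w => w - c) z
  (fun n => if n == 0%N then z - c else if n == 1%N then 1 else 0).
Proof.
have := expandsD (expands_id z) (expands_cst (- c) z).
congr expands; apply/funext => n; case: n => [|[|n]] //=; by rewrite addr0.
Qed.

Lemma analytic_subX (c : C) z : analytic_at (fun w => w - c) z.
Proof. by apply/analytic_atP; eexists; exact: expands_subX. Qed.

Lemma analyticX F k z : analytic_at F z -> analytic_at (fun w => F w ^+ k) z.
Proof.
move=> Fz; elim: k => [|k IH]; first exact: analytic_cst.
by apply: analytic_ext (analyticM Fz IH) => w; rewrite exprS.
Qed.

Lemma near_neq0 F z : {for z, continuous F} -> F z != 0 -> \forall w \near z, F w != 0.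
Proof.
move=> /continuousCP cF; rewrite -cmod_gt0 => Fz.
have [r r0 rP] := cF _ Fz; apply/nbhsCP; exists r => // w /rP.
by rewrite cmod_distC; apply: contraTneq => ->; rewrite subr0 ltxx.
Qed.

Lemma near_neq (c z : C) : z != c -> \forall w \near z, w != c.
Proof.
move=> zc.
have := near_neq0 (analytic_continuous (analytic_subX c z)).
by rewrite subr_eq0 => /(_ zc); apply: filterS => w; rewrite subr_eq0.
Qed.

Lemma dnearW z (P : C -> Prop) : (\forall w \near z, P w) -> \forall w \near z^', P w.
Proof. by move=> /nbhsCP[e e0 eP]; apply/dnbhsCP; exists e => // w we _; exact: eP. Qed.

Lemma analytic_meromorphic F z : analytic_at F z -> meromorphic_at F z.
Proof.
move=> Fz; exists 0%N, F; split=> //; apply: nearW => w.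
by rewrite expr0 divr1.
Qed.

Lemma meromorphic_near F G z : meromorphic_at F z ->
  (\forall w \near z^', G w = F w) -> meromorphic_at G z.
Proof.
move=> [k [h [hz Fh]]] GF; exists k, h; split=> //.
by apply: filterS2 GF Fh => w -> ->.
Qed.

Lemma meromorphicD_analytic F G z : meromorphic_at F z -> analytic_at G z ->
  meromorphic_at (fun w => F w + G w) z.
Proof.
move=> [k [h [hz Fh]]] Gz; exists k, (fun w => h w + G w * (w - z) ^+ k); split.
  by apply: analyticD hz (analyticM Gz (analyticX k (analytic_subX z z))).
have W : \forall w \near z^', w != z by exact: nbhs_dnbhs_neq.
apply: filterS2 Fh W => w -> wz.
by rewrite mulrDl mulfK// expf_neq0// subr_eq0.
Qed.

Lemma meromorphicM_analytic F G z : meromorphic_at F z -> analytic_at G z ->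
  meromorphic_at (fun w => F w * G w) z.
Proof.
move=> [k [h [hz Fh]]] Gz; exists k, (fun w => h w * G w); split.
  exact: analyticM hz Gz.
by apply: filterS Fh => w ->; rewrite mulrAC.
Qed.

Lemma continuous_eq_dnbhs F G z : {for z, continuous F} -> {for z, continuous G} ->
  (\forall w \near z^', F w = G w) -> F z = G z.
Proof.
move=> /continuousCP cF /continuousCP cG /dnbhsCP[e e0 eP].
apply/eqP; rewrite -subr_eq0 -cmod_eq0 eq_le cmod_ge0 andbT leNgt; apply/negP => d0.
have d2 : 0 < cmod (F z - G z) / 2 by lra.
have [r r0 rP] := cF _ d2; have [s s0 sP] := cG _ d2.
pose t := Num.min e (Num.min r s) / 2.
have m0 : 0 < Num.min e (Num.min r s) by rewrite !lt_min e0 r0.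
have t0 : 0 < t by rewrite divr_gt0.
have tm : t < Num.min e (Num.min r s) by rewrite /t; lra.
move: tm; rewrite !lt_min => /and3P[te tr ts].
have ct : cmod (z + t%:C - z) = t by rewrite addrC addKr cmod_real gtr0_norm.
have wz : z + t%:C != z by rewrite -subr_eq0 -cmod_eq0 ct gt_eqF.
have := rP (z + t%:C); have := sP (z + t%:C); rewrite ct => /(_ ts) A1 /(_ tr).
rewrite (eP (z + t%:C))// ?ct// => A2.
have : F z - G z = (G (z + t%:C) - G z) - (G (z + t%:C) - F z) by ring.
move=> E; have := cmodB (G (z + t%:C) - G z) (G (z + t%:C) - F z).
by rewrite -E; lra.
Qed.

(* A continuous function cannot have a pole, so the numerator absorbs the
   denominator one factor at a time. *)
Lemma meromorphic_continuous F z : meromorphic_at F z -> {for z, continuous F} ->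
  analytic_at F z.
Proof.
move=> [k [h [/analytic_atP[a ha] Fh]]] cF.
elim: k h a ha Fh => [|k IH] h a ha Fh.
  have Fz : F z = h z.
    apply: continuous_eq_dnbhs cF (expands_continuous_center ha) _.
    by apply: filterS Fh => w ->; rewrite expr0 divr1.
  apply/analytic_atP; exists a; apply: expands_near ha _.
  move/dnbhsCP: Fh => [e e0 eP]; apply/nbhsCP; exists e => // w we.
  by have [->//|wz] := eqVneq w z; rewrite eP// expr0 divr1.
have a0 : a 0%N = 0.
  rewrite -(expands_center ha).
  have cX : {for z, continuous (fun w => (w - z) ^+ k.+1)}.
    exact: analytic_continuous (analyticX k.+1 (analytic_subX z z)).
  have cFX : {for z, continuous (fun w => F w * (w - z) ^+ k.+1)} := continuousM cF cX.
  have <- : F z * (z - z) ^+ k.+1 = 0 by rewrite subrr expr0n mulr0.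
  apply: continuous_eq_dnbhs (expands_continuous_center ha) cFX _.
  have W : \forall w \near z^', w != z by exact: nbhs_dnbhs_neq.
  apply: filterS2 Fh W => w /= -> wz.
  by rewrite divfK// expf_neq0// subr_eq0.
apply: IH (expands_divX a0 ha) _.
have W : \forall w \near z^', w != z by exact: nbhs_dnbhs_neq.
apply: filterS2 Fh W => w -> wz.
by rewrite (negbTE wz) exprS invfM mulrA.
Qed.

End Analytic.

(** * The reduction at the remaining nodes *)

Section Reduction.
Local Open Scope complex_scope.
Local Open Scope classical_set_scope.
Variable R : realType.
Local Notation C := (R[i]^o).
Local Notation Re := (@complex.Re R).
Local Notation Im := (@complex.Im R).
Implicit Types (f g F G H : C -> C) (z w c d s : C) (a : nat -> C) (x : R).

Lemma expandsN F z a : expands F z a -> expands (fun w => - F w) z (fun n => - a n).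
Proof.
move=> /(expandsZ (-1)); congr expands; apply/funext => n; exact: mulN1r.
Qed.

Lemma analyticN F z : analytic_at F z -> analytic_at (fun w => - F w) z.
Proof.
by move=> /analytic_atP[a /expandsN Fa]; apply/analytic_atP; eexists; exact: Fa.
Qed.

(** These two coefficients are the corrections by v_1 and x_j - x_1 in w_j' and v_j'. *)
Lemma expands_kernel (v c z : C) : v != 0 -> z != c ->
  exists a, [/\ expands (fun w => (v * (w - c))^-1) z a,
    a 0%N = (v * (z - c))^-1 & a 1%N = - (v * (z - c) ^+ 2)^-1].
Proof.
move=> v0 zc; have := expandsZ v (expands_subX c z).
move=> /expandsV[|a [za a0 a1]]; first by rewrite /= mulf_neq0// subr_eq0.
exists a; split=> //; rewrite a1 /=.
by rewrite mulr1 exprMn mulNr [v ^+ 2]expr2 -mulrA invfM mulrA divff// mul1r.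
Qed.

Lemma analytic_kernel (v c z : C) : v != 0 -> z != c ->
  analytic_at (fun w => (v * (w - c))^-1) z.
Proof.
by move=> v0 zc; apply/analytic_atP; have [a [za _ _]] := expands_kernel v0 zc; exists a.
Qed.

Lemma boundary_value_expands f x c d : boundary_value f x c d ->
  exists F a, [/\ \forall z \near (x%:C : C), analytic_at F z, extends_near f x F,
                 expands F x%:C a, a 0%N = c & a 1%N = d].
Proof.
move=> [F [[FA Ff] Fc Fd]].
have /analytic_atP[a Fa] := nbhs_singleton FA.
exists F, a; split=> //; first by rewrite -(expands_center Fa).
have := expands_is_derive Fa => Fa1.
by rewrite -(@derive_val _ _ _ _ _ _ _ Fd) -(@derive_val _ _ _ _ _ _ _ Fa1).
Qed.

Lemma boundary_pole_expands f x s : boundary_pole f x 1%N s ->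
  exists F a, [/\ \forall z \near (x%:C : C), meromorphic_at F z, extends_near f x F,
    expands (fun w => if w == x%:C then s else F w * (w - x%:C)) x%:C a,
    s != 0 & a 0%N = s].
Proof.
move=> [F [[FM Ff] /has_pole_expands[a [_ a0 /= as_ Fa]]]].
by exists F, a; rewrite -as_.
Qed.

Lemma boundary_valueI g x G a :
  (\forall z \near (x%:C : C), analytic_at G z) -> extends_near g x G ->
  expands G x%:C a ->
  boundary_value g x (a 0%N) (a 1%N) /\ exists F, meromorphic_extension g x F.
Proof.
move=> GA Gg Ga; split; exists G; split=> //.
- exact: expands_center Ga.
- exact: expands_is_derive.
- by apply: filterS GA => z; exact: analytic_meromorphic.
Qed.

Lemma boundary_poleI g x G H a :
  (\forall z \near (x%:C : C)^', meromorphic_at G z) -> extends_near g x G ->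
  expands H x%:C a -> a 0%N != 0 ->
  (\forall z \near (x%:C : C)^', G z = H z / (z - x%:C)) ->
  boundary_pole g x 1%N (a 0%N) /\ exists F, meromorphic_extension g x F.
Proof.
move=> GM Gg Ha a0 GH.
have Gx : meromorphic_extension g x G.
  split=> //; move/dnbhsCP: GM => [e e0 eP]; apply/nbhsCP; exists e => // z ze.
  have [->|zx] := eqVneq z x%:C; last exact: eP.
  exists 1%N, H; split; first by apply/analytic_atP; exists a.
  by apply: filterS GH => w ->; rewrite expr1.
by split; exists G => //; split=> //; exact: expands_has_pole Ha GH.
Qed.

(** * Another node when the value at the reduced node is finite *)

Section Node.
Variables (f g : C -> C) (c v : C) (x0 x : R).
Hypotheses (v0 : v != 0) (xx0 : x != x0).

Let kernel (z : C) : C := (v * (z - x0%:C))^-1.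

Let xC : (x%:C : C) != x0%:C.
Proof. by apply: contraNneq xx0 => /complexI ->. Qed.

Hypothesis gE : forall z, upper_half_plane z -> g z = - (f z - c)^-1 + kernel z.

Lemma reduction_value_regular b d : b != c -> boundary_value f x b d ->
  boundary_value g x (- (b - c)^-1 + (v * (x%:C - x0%:C))^-1)
    (d / (b - c) ^+ 2 - (v * (x%:C - x0%:C) ^+ 2)^-1) /\
  exists F, meromorphic_extension g x F.
Proof.
move=> bc /boundary_value_expands[F [a [FA Ff Fa a0 a1]]].
have bc0 : b - c != 0 by rewrite subr_eq0.
have Fca := expandsD Fa (expands_cst (- c) x%:C).
have [|a' [FcV a'0 a'1]] := expandsV _ Fca; first by rewrite /= a0.
have [k [kE k0 k1]] := expands_kernel v0 xC.
have := @boundary_valueI g x (fun z => - (F z - c)^-1 + kernel z)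
  (fun n => - a' n + k n).
rewrite a'0 a'1 k0 k1 /= a0 a1 addr0 mulNr opprK; apply; last first.
- exact: expandsD (expandsN FcV) kE.
- by apply: filterS Ff => z Ff zP; rewrite gE// Ff.
have Fc0 : \forall z \near (x%:C : C), F z - c != 0.
  apply: near_neq0 (expands_continuous_center Fca) _.
  by rewrite (expands_center Fa) a0.
near=> z.
have z1 : F z - c != 0 by near: z.
have z2 : analytic_at F z by near: z.
have z3 : z != x0%:C by near: z; exact: near_neq.
apply: analyticD (analytic_kernel v0 z3).
have z4 : analytic_at (fun w => F w - c) z := analyticD z2 (analytic_cst (- c) z).
exact: analyticN (analyticV z4 z1).
Unshelve. all: by end_near. Qed.

(** Here F - c = (z - x) Q with Q x = d, so -1/(F - c) has a simple pole of residue -1/d; the kernel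
    is analytic at x and leaves it alone. *)
Lemma reduction_value_pole d : d != 0 -> boundary_value f x c d ->
  boundary_pole g x 1%N (- d^-1) /\ exists F, meromorphic_extension g x F.
Proof.
move=> d0 /boundary_value_expands[F [a [FA Ff Fa a0 a1]]].
have Fca := expandsD Fa (expands_cst (- c) x%:C).
have {Fca} := expands_divX _ Fca; rewrite /= a0 subrr a1 addr0 => /(_ erefl).
set Q := fun w => _; set a' := fun n => _ => Qa.
have a'0 : a' 0%N = d by rewrite /a' a1 /= addr0.
have [|q [QV q0 _]] := expandsV _ Qa; first by rewrite a'0.
have [k [kE _ _]] := expands_kernel v0 xC.
have Ha := expandsD (expandsN QV) (expandsM kE (expands_subX x%:C x%:C)).
have := boundary_poleI _ _ Ha.
rewrite /= big_ord1 q0 a'0 subrr mulr0 addr0 => /(_ g (fun z => - (F z - c)^-1 + kernel z)); apply.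
- have Q0 : \forall z \near (x%:C : C), Q z != 0.
    apply: near_neq0 (expands_continuous_center Qa) _.
    by rewrite (expands_center Qa) a'0.
  have W : \forall w \near (x%:C : C)^', w != x%:C by exact: nbhs_dnbhs_neq.
  near=> z.
  have z0 : z != x%:C by near: z.
  have z1 : Q z != 0 by near: z; exact: dnearW.
  have z2 : analytic_at F z by near: z; exact: dnearW.
  have z3 : z != x0%:C by near: z; apply: dnearW; exact: near_neq.
  have z4 : F z - c != 0.
    by apply: contraNneq z1 => E; rewrite /Q (negbTE z0) E mul0r.
  apply: analytic_meromorphic; apply: analyticD (analytic_kernel v0 z3).
  have z5 : analytic_at (fun w => F w - c) z := analyticD z2 (analytic_cst (- c) z).
  exact: analyticN (analyticV z5 z4).
- by apply: filterS Ff => z Ff zP; rewrite gE// Ff.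
- by rewrite oppr_eq0 invr_eq0.
have W : \forall w \near (x%:C : C)^', w != x%:C by exact: nbhs_dnbhs_neq.
apply: filterS W => z zx.
have zx0 : z - x%:C != 0 by rewrite subr_eq0.
by rewrite /Q (negbTE zx) invfM invrK mulrDl mulNr !mulfK.
Unshelve. all: by end_near. Qed.

(** With f = H / (z - x), -1/(f - c) = -(z - x) / (H - c (z - x)) vanishes at x with derivative
    -1/s, so the value there comes from the kernel alone. *)
Lemma reduction_pole_value s : boundary_pole f x 1%N s ->
  boundary_value g x (v * (x%:C - x0%:C))^-1
    (- s^-1 - (v * (x%:C - x0%:C) ^+ 2)^-1) /\
  exists F, meromorphic_extension g x F.
Proof.
move=> /boundary_pole_expands[F [a [FM Ff]]].
set H := fun w => _ => Ha s0 a0.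
have Dc := expandsD Ha (expandsZ (- c) (expands_subX x%:C x%:C)).
have [|a' [DV a'0 a'1]] := expandsV _ Dc; first by rewrite /= a0 subrr mulr0 addr0.
have [k [kE k0 k1]] := expands_kernel v0 xC.
have Ga := expandsD (expandsN (expandsM (expands_subX x%:C x%:C) DV)) kE.
have := boundary_valueI _ _ Ga.
rewrite !big_ord_recr !big_ord0 /= subrr !mul0r !add0r mul1r oppr0 add0r k0 k1.
rewrite a'0 /= a0 subrr mulr0 addr0.
apply.
- have D0 : \forall z \near (x%:C : C), H z + - c * (z - x%:C) != 0.
    apply: near_neq0 (expands_continuous_center Dc) _.
    by rewrite (expands_center Dc) /= a0 subrr mulr0 addr0.
  have Hc := expands_continuous Ha.
  near=> z.
  have z1 : H z + - c * (z - x%:C) != 0 by near: z.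
  have z3 : z != x0%:C by near: z; exact: near_neq.
  have z4 : {for z, continuous H} by near: z.
  have z5 : meromorphic_at F z by near: z.
  (* F is merely meromorphic near x; away from x, H inherits meromorphy from F and is continuous as
     the sum of its series at x, hence analytic. *)
  have HA : analytic_at H z.
    have [zx|zx] := eqVneq z x%:C; first by apply/analytic_atP; exists a; rewrite zx.
    apply: meromorphic_continuous z4.
    apply: meromorphic_near (meromorphicM_analytic z5 (analytic_subX x%:C z)) _.
    apply: dnearW; apply: filterS (near_neq zx) => w wx.
    by rewrite /H (negbTE wx).
  apply: analyticD (analytic_kernel v0 z3).
  have DA : analytic_at (fun w => H w + - c * (w - x%:C)) z.
    exact: analyticD HA (analyticM (analytic_cst (- c) z) (analytic_subX x%:C z)).
  exact: analyticN (analyticM (analytic_subX x%:C z) (analyticV DA z1)).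
- apply: filterS Ff => z Ff zP; rewrite gE// -Ff//.
  have zx : z != x%:C by apply: contraTneq zP => ->; rewrite /upper_half_plane /= ltxx.
  have zx0 : z - x%:C != 0 by rewrite subr_eq0.
  congr (- _ + _); rewrite /H (negbTE zx) -mulrDl invfM mulrCA divff// mulr1.
Unshelve. all: by end_near. Qed.

End Node.

(** * Another node when the reduced node is a pole *)

Section PoleNode.
Variables (f g : C -> C) (v : C) (x0 x : R).
Hypotheses (v0 : v != 0) (xx0 : x != x0).

Let kernel (z : C) : C := (v * (z - x0%:C))^-1.

Let xC : (x%:C : C) != x0%:C.
Proof. by apply: contraNneq xx0 => /complexI ->. Qed.

Hypothesis gE : forall z, upper_half_plane z -> g z = f z + kernel z.

Lemma pole_reduction_value b d : boundary_value f x b d ->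
  boundary_value g x (b + (v * (x%:C - x0%:C))^-1)
    (d - (v * (x%:C - x0%:C) ^+ 2)^-1) /\
  exists F, meromorphic_extension g x F.
Proof.
move=> /boundary_value_expands[F [a [FA Ff Fa a0 a1]]].
have [k [kE k0 k1]] := expands_kernel v0 xC.
have := boundary_valueI _ _ (expandsD Fa kE); rewrite a0 a1 k0 k1; apply.
- near=> z; have z3 : z != x0%:C by near: z; exact: near_neq.
  by apply: analyticD (analytic_kernel v0 z3); near: z.
- by apply: filterS Ff => z Ff zP; rewrite gE// Ff.
Unshelve. all: by end_near. Qed.

Lemma pole_reduction_pole s : boundary_pole f x 1%N s ->
  boundary_pole g x 1%N s /\ exists F, meromorphic_extension g x F.
Proof.
move=> /boundary_pole_expands[F [a [FM Ff]]].
set H := fun w => _ => Ha s0 a0.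
have [k [kE _ _]] := expands_kernel v0 xC.
have Ga := expandsD Ha (expandsM kE (expands_subX x%:C x%:C)).
have := boundary_poleI _ _ Ga.
rewrite /= big_ord1 subrr mulr0 addr0 a0 => /(_ g (fun z => F z + kernel z)); apply=> //.
- near=> z; have z3 : z != x0%:C by near: z; apply: dnearW; exact: near_neq.
  apply: meromorphicD_analytic (analytic_kernel v0 z3).
  by near: z; exact: dnearW.
- by apply: filterS Ff => z Ff zP; rewrite gE// Ff.
have W : \forall w \near (x%:C : C)^', w != x%:C by exact: nbhs_dnbhs_neq.
apply: filterS W => z zx.
have zx0 : z - x%:C != 0 by rewrite subr_eq0.
by rewrite /H (negbTE zx) mulrDl !mulfK.
Unshelve. all: by end_near. Qed.

End PoleNode.

(** * The reduction belongs to the Pick class *)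

Lemma Im_inv z : Im z^-1 = - (Im z / cmod z ^+ 2).
Proof. by rewrite cmod_sqr; case: z => p q /=. Qed.

Lemma cmod_upper_gt0 z x : 0 < Im z -> 0 < cmod (z - x%:C) ^+ 2.
Proof.
move=> z0; rewrite exprn_gt0// cmod_gt0 subr_eq0.
by apply: contraTneq z0 => ->; rewrite /= ltxx.
Qed.

Lemma Im_kernel (v x : R) z :
  Im (v%:C * (z - x%:C))^-1 = - (Im z / (v * cmod (z - x%:C) ^+ 2)).
Proof.
rewrite Im_inv cmodM exprMn cmod_real real_normK ?num_real// cImM cImD cImN /=.
(* For v = 0 both sides are 0, by the convention 0^-1 = 0. *)
have [->|v0] := eqVneq v 0; first by rewrite !mul0r add0r mul0r invr0 mulr0.
by rewrite subr0 mul0r addr0 [v ^+ 2]expr2 -[v * v * _]mulrA -mulf_div divff// mul1r.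
Qed.

(* As Im (- 1 / u) = Im u / |u|^2, Julia's inequality is the claim Im (g z) >= 0. *)
Lemma pick_value_reduction f g x (c d : R) : pick_class f -> 0 < d ->
  boundary_value f x c%:C d%:C ->
  (forall z, upper_half_plane z -> g z = - (f z - c%:C)^-1 + (d%:C * (z - x%:C))^-1) ->
  pick_class g.
Proof.
move=> fP d0 fx gE.
(* A real value inside the half-plane would make f constant, against d > 0. Hence f - c, with c
   real, has no zero there. *)
have fI z : upper_half_plane z -> 0 < Im (f z).
  move=> z0; rewrite lt_neqAle eq_sym (fP.2 z z0) andbT; apply: contraTneq d0 => Iz.
  have fk w : upper_half_plane w -> f w = f z by exact: pick_Im_eq0 fP z0 Iz.
  by rewrite (boundary_value_cst fx fk) ltxx.
split=> z z0.
  have fz : f z - c%:C != 0.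
    by rewrite subr_eq0; apply: contraTneq (fI z z0) => ->; rewrite /= ltxx.
  have zx : z != x%:C by apply: contraTneq z0 => ->; rewrite /upper_half_plane /= ltxx.
  have dC : (d%:C : C) != 0 by rewrite -cmod_gt0 cmod_real normr_gt0 gt_eqF.
  apply: (@analytic_near _ (fun w => - (f w - c%:C)^-1 + (d%:C * (w - x%:C))^-1)).
    apply: analyticD (analytic_kernel dC zx).
    have fA : analytic_at (fun w => f w - c%:C) z.
      exact: analyticD (fP.1 z z0) (analytic_cst (- c%:C) z).
    exact: analyticN (analyticV fA fz).
  (* The formula for g holds only on the half-plane; the disc of radius Im z stays inside it. *)
  apply/nbhsCP; exists (Im z) => // w wz; apply: gE; rewrite /upper_half_plane /=.
  have := ler_Im_cmod (w - z); rewrite cImD cImN => A.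
  by have := le_lt_trans A wz; rewrite ltr_norml; lra.
rewrite gE// cImD cImN Im_inv opprK Im_kernel cImD cImN /= oppr0 addr0 subr_ge0.
have fz : 0 < cmod (f z - c%:C) ^+ 2 by apply: cmod_upper_gt0; exact: fI.
have zz := cmod_upper_gt0 x z0.
have D0 : 0 < d * cmod (z - x%:C) ^+ 2 by rewrite mulr_gt0.
rewrite (ler_pdivrMr _ _ D0) mulrAC (ler_pdivlMr _ _ fz).
by rewrite [leRHS]mulrA; exact: julia_value.
Qed.

(** Adding the kernel lowers the imaginary part by Im z / (v |z - x|^2), which Julia's inequality at
    a pole of residue -1/v bounds by Im (f z). *)
Lemma pick_pole_reduction f g x (v : R) : pick_class f -> 0 < v ->
  boundary_pole f x 1%N (- v^-1)%:C ->
  (forall z, upper_half_plane z -> g z = f z + (v%:C * (z - x%:C))^-1) ->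
  pick_class g.
Proof.
move=> fP v0 fx gE.
split=> z z0.
  have zx : z != x%:C by apply: contraTneq z0 => ->; rewrite /upper_half_plane /= ltxx.
  have vC : (v%:C : C) != 0 by rewrite -cmod_gt0 cmod_real normr_gt0 gt_eqF.
  apply: (@analytic_near _ (fun w => f w + (v%:C * (w - x%:C))^-1)).
    exact: analyticD (fP.1 z z0) (analytic_kernel vC zx).
  apply/nbhsCP; exists (Im z) => // w wz; apply: gE; rewrite /upper_half_plane /=.
  have := ler_Im_cmod (w - z); rewrite cImD cImN => A.
  by have := le_lt_trans A wz; rewrite ltr_norml; lra.
rewrite gE// cImD Im_kernel subr_ge0.
have zz := cmod_upper_gt0 x z0.
have D0 : 0 < v * cmod (z - x%:C) ^+ 2 by rewrite mulr_gt0.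
rewrite (ler_pdivrMr _ _ D0).
have := julia_pole fP fx z0; rewrite opprK sqrrN => J.
have := ler_wpM2r (ltW (exprn_gt0 2 v0)) J.
have vV : v * v^-1 = 1 by rewrite divff// gt_eqF.
have -> : Im z * v^-1 ^+ 2 * v ^+ 2 = Im z * (v * v^-1) ^+ 2 by ring.
have -> : Im (f z) / v * cmod (z - x%:C) ^+ 2 * v ^+ 2 =
  Im (f z) * (v * cmod (z - x%:C) ^+ 2) * (v * v^-1) by ring.
by rewrite vV expr1n !mulr1.
Qed.

End Reduction.

(** * Pick matrices and the reduced problem *)

Section Problem.
Local Open Scope complex_scope.
Variables (R : realType) (n : nat).
Variables (x : 'I_n.+1 -> R) (w : 'I_n.+1 -> option R) (v : 'I_n.+1 -> R).
Hypotheses (data : problem_data x w v) (v1_gt0 : 0 < v ord0).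
Local Notation C := (R[i]^o).

Lemma schurE (M : 'M[R]_(1 + n)) i j :
  schur M i j = M (lift ord0 i) (lift ord0 j) -
    M (lift ord0 i) ord0 * (M ord0 ord0)^-1 * M ord0 (lift ord0 j).
Proof.
have l0 : lshift n ord0 = ord0 :> 'I_(1 + n) by apply/val_inj.
have r1 k : rshift 1 k = lift ord0 k :> 'I_(1 + n) by apply/val_inj.
rewrite /schur [ulsubmx M]mx11_scalar invmx_scalar mul_mx_scalar.
rewrite !mxE big_ord1 !mxE !r1 l0; congr (_ - _).
by rewrite [_ * _^-1]mulrC.
Qed.

(** Writing w_j = p/q with q = 1, or p = 1 and q = 0 at infinity, the scaling for real w_1 is w_1 q
    - p, replaced by 1 where it vanishes; this is the source of the -1. Each pattern of finite and
    infinite values is then an identity of rational functions. *)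
Lemma reduced_pick_matrix (L := diag_mx (reduction_scaling w)) :
  L *m pick_matrix (reduced_node x) (reduced_value x w v) (reduced_slope x w v) *m L =
  schur (pick_matrix x w v).
Proof.
have [xI _ _] := data; apply/matrixP => i j.
rewrite schurE mul_mx_diag mxE mul_diag_mx !mxE.
rewrite (inj_eq (@lift_inj _ ord0)) !eqxx.
have l0 k : (lift ord0 k == ord0) = false by apply/negbTE; rewrite eq_sym neq_lift.
have l1 k : (ord0 == lift ord0 k) = false by apply/negbTE; rewrite neq_lift.
rewrite !l0 !l1 /reduced_node /reduced_value /reduced_slope.
have x0 k : x (lift ord0 k) - x ord0 != 0 by rewrite subr_eq0 (inj_eq xI) l0.
have v0 : v ord0 != 0 by rewrite gt_eqF.
have flip (p q : R) : p - q != 0 -> q - p != 0 by rewrite -oppr_eq0 opprB.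
case: (eqVneq i j) => [->|ij].
  move: (x0 j) (flip _ _ (x0 j)) v0.
  move: (x (lift ord0 j)) (x ord0) (v ord0) (v (lift ord0 j)) => xj x00 v0 vj d1 d2 v00.
  case: (w ord0) => [a|]; case: (w (lift ord0 j)) => [b|].
  - case: (eqVneq b a) => [->|].
      by rewrite !subrr !mul0r subr0 mul1r mulr1.
    rewrite -subr_eq0 => ba; have ab := flip _ _ ba.
    by field; rewrite ?d1 ?d2 ?v00 ?ba ?ab.
  - by field; rewrite ?d1 ?d2 ?v00.
  - by field; rewrite ?d1 ?d2 ?v00.
  - by rewrite !mul0r subr0 mul1r mulr1.
have xij : x (lift ord0 i) - x (lift ord0 j) != 0.
  by rewrite subr_eq0 (inj_eq xI) (inj_eq (@lift_inj _ ord0)).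
move: (x0 j) (flip _ _ (x0 j)) (x0 i) (flip _ _ (x0 i)) xij (flip _ _ xij) v0.
move: (x (lift ord0 i)) (x (lift ord0 j)) (x ord0) (v ord0).
move=> xi xj x00 v0 dj dj' di di' dij dij' v00.
case: (w ord0) => [a|]; case: (w (lift ord0 i)) => [b|]; case: (w (lift ord0 j)) => [c|].
- case: (eqVneq b a) => [->|]; case: (eqVneq c a) => [->|].
  + by rewrite !subrr !mul0r !mulr0 subr0 mul0r.
  + rewrite -subr_eq0 => ca; have ac := flip _ _ ca; rewrite subrr.
    by field; rewrite ?dj ?dj' ?di ?di' ?dij ?dij' ?v00 ?ca ?ac.
  + rewrite -subr_eq0 => ba; have ab := flip _ _ ba; rewrite subrr.
    by field; rewrite ?dj ?dj' ?di ?di' ?dij ?dij' ?v00 ?ba ?ab.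
  rewrite -subr_eq0 => ca; rewrite -subr_eq0 => ba.
  have ac := flip _ _ ca; have ab := flip _ _ ba.
  by field; rewrite ?dj ?dj' ?di ?di' ?dij ?dij' ?v00 ?ba ?ab ?ca ?ac.
- case: (eqVneq b a) => [->|].
    by rewrite subrr; field; rewrite ?dj ?dj' ?di ?di' ?dij ?dij' ?v00.
  rewrite -subr_eq0 => ba; have ab := flip _ _ ba.
  by field; rewrite ?dj ?dj' ?di ?di' ?dij ?dij' ?v00 ?ba ?ab.
- case: (eqVneq c a) => [->|].
    by rewrite subrr; field; rewrite ?dj ?dj' ?di ?di' ?dij ?dij' ?v00.
  rewrite -subr_eq0 => ca; have ac := flip _ _ ca.
  by field; rewrite ?dj ?dj' ?di ?di' ?dij ?dij' ?v00 ?ca ?ac.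
- by field; rewrite ?dj ?dj' ?di ?di' ?dij ?dij' ?v00.
- by field; rewrite ?dj ?dj' ?di ?di' ?dij ?dij' ?v00.
- by field; rewrite ?dj ?dj' ?di ?di' ?dij ?dij' ?v00.
- by field; rewrite ?dj ?dj' ?di ?di' ?dij ?dij' ?v00.
by rewrite !mul0r !mulr0 subr0 mul0r.
Qed.

Variable f : C -> C.
Hypothesis f_sol : is_solution x w v f.

Lemma reduced_node_neq j : x (lift ord0 j) != x ord0.
Proof. by case: data => xI _ _; rewrite (inj_eq xI) eq_sym neq_lift. Qed.

(** Each corrected slope is the 2 by 2 Pick determinant on x_1 and x_j up to a positive factor. *)
Lemma reduced_problem_data :
  problem_data (reduced_node x) (reduced_value x w v) (reduced_slope x w v).
Proof.
have [xI v_ge0 v_gt0] := data; have [fP _ fB] := f_sol.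
have pole_value (p q c d s : R) : p != q -> 0 < s -> 0 < d ->
    boundary_value f p c%:C d%:C -> boundary_pole f q 1%N (- s^-1)%:C ->
    (d * (q - p) ^+ 2)^-1 <= s.
  move=> pq s0 d0 fp fq; have := pick_value_pole fP fp fq; rewrite opprK sqrrN => A.
  have qp : 0 < (q - p) ^+ 2 by rewrite exprn_even_gt0//= subr_eq0 eq_sym.
  have D0 : 0 < d * (q - p) ^+ 2 by rewrite mulr_gt0.
  rewrite -[_^-1]mul1r ler_pdivrMr// mulrA.
  have := ler_wpM2l (ltW (exprn_gt0 2 s0)) A.
  have sV : s * s^-1 = 1 by rewrite divff// gt_eqF.
  have -> : s ^+ 2 * s^-1 ^+ 2 = (s * s^-1) ^+ 2 by ring.
  have -> : s ^+ 2 * (s^-1 * d * (q - p) ^+ 2) = s * d * (q - p) ^+ 2 * (s * s^-1) by ring.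
  by rewrite sV expr1n mulr1.
split=> [i j /xI/lift_inj//|j|j].
  rewrite /reduced_slope; have := fB ord0; have := fB (lift ord0 j).
  have := v_gt0 (lift ord0 j).
  case E0: (w ord0) => [a|]; case Ej: (w (lift ord0 j)) => [b|] vj.
  - case: eqVneq => [//|ba] fj f0; rewrite subr_ge0.
    have := pick_value_value fP f0 fj.
    have b2 : 0 < (b - a) ^+ 2 by rewrite exprn_even_gt0//= subr_eq0.
    have x2 : 0 < (x (lift ord0 j) - x ord0) ^+ 2.
      by rewrite exprn_even_gt0//= subr_eq0 reduced_node_neq.
    have D0 : 0 < v ord0 * (x (lift ord0 j) - x ord0) ^+ 2 by rewrite mulr_gt0.
    by move=> A; rewrite -[_^-1]mul1r ler_pdivrMr// mulrAC ler_pdivlMr// mul1r mulrA.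
  - move=> fj f0; rewrite subr_ge0.
    by apply: pole_value f0 fj => //; [rewrite eq_sym reduced_node_neq|exact: vj].
  - move=> fj f0; rewrite subr_ge0; have := v_ge0 (lift ord0 j).
    (* For w_1 = oo and w_j real the nodes exchange roles, which divides by v_j; v_j = 0 is
       excluded, as it would give (1/v_1)^2 <= 0. *)
    rewrite le_eqVlt => /orP[/eqP vj0|vj0].
      have := pick_value_pole fP fj f0; rewrite -vj0 mulr0 mul0r.
      by rewrite sqrrN leNgt exprn_gt0// invr_gt0.
    have x2 : 0 < (x (lift ord0 j) - x ord0) ^+ 2.
      by rewrite exprn_even_gt0//= subr_eq0 reduced_node_neq.
    have := pole_value _ _ _ _ _ (reduced_node_neq j) v1_gt0 vj0 fj f0.
    rewrite -[(x ord0 - _) ^+ 2]sqrrN opprB.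
    have D1 := mulr_gt0 vj0 x2; have D0 := mulr_gt0 v1_gt0 x2.
    rewrite -[_^-1]mul1r (ler_pdivrMr _ _ D1) => A.
    by rewrite -[_^-1]mul1r (ler_pdivrMr _ _ D0) mulrCA.
  - by move=> *; exact: v_ge0.
rewrite /reduced_slope /reduced_value; have := fB ord0; have := fB (lift ord0 j).
have := v_gt0 (lift ord0 j); have := v_ge0 (lift ord0 j).
case E0: (w ord0) => [a|]; case Ej: (w (lift ord0 j)) => [b|] // vj vj' fj f0.
  (* For real w_j = w_1 the data give only v_j >= 0, but the new value oo demands v_j > 0. *)
  by case: eqVneq => // _ _; exact: pick_slope_gt0 fP v1_gt0 f0 fj vj.
Qed.

Lemma reduction_exists : exists g, is_reduction f (x ord0) g.
Proof.
have [fP _ fB] := f_sol; have := fB ord0.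
case: (w ord0) => [a|] f0.
  exists (fun z => - (f z - a%:C)^-1 + ((v ord0)%:C * (z - (x ord0)%:C))^-1).
  split=> //; left; split; last by exists a, (v ord0)%:C.
  move=> [c fc]; move: v1_gt0; rewrite (boundary_value_cst f0 fc).
  by rewrite ltxx.
exists (fun z => f z - (- (v ord0)^-1)%:C / (z - (x ord0)%:C)).
by split=> //; right; exists 1%N, (- (v ord0)^-1)%:C.
Qed.

(** The boundary value or pole witnessing the reduction is matched with the data by uniqueness; a
    value cannot coexist with a pole. As the residue is -1/v_1, the kernel is the same in both
    cases. *)
Lemma reduction_formula g z : is_reduction f (x ord0) g -> upper_half_plane z ->
  g z = (if w ord0 is Some a then - (f z - a%:C)^-1 else f z) +
        ((v ord0)%:C * (z - (x ord0)%:C))^-1.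
Proof.
move=> [_ red] z0; have [_ _ fB] := f_sol; move: red; have := fB ord0.
case: (w ord0) => [a|] f0 [[_ [c [d [fc gE]]]]|[k [r [fr gE]]]].
- have [/complexI ca dv] := boundary_value_unique fc f0.
  by rewrite gE// ca dv.
- by case: (boundary_pole_value_absurd fr f0).
- by case: (boundary_pole_value_absurd f0 fc).
have s0 : ((- (v ord0)^-1)%:C : C) != 0.
  by rewrite -cmod_gt0 cmod_real normr_gt0 oppr_eq0 invr_eq0 gt_eqF.
rewrite gE// (boundary_pole_order s0 fr f0) rmorphN fmorphV mulNr opprK invfM.
by [].
Qed.

Lemma reduction_is_solution g : is_reduction f (x ord0) g ->
  is_solution (reduced_node x) (reduced_value x w v) (reduced_slope x w v) g.
Proof.
move=> red; have [fP _ fB] := f_sol; have [xI v_ge0 v_gt0] := data.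
have [_ _ v'_gt0] := reduced_problem_data.
have gE z := @reduction_formula g z red.
have vC : ((v ord0)%:C : C) != 0 by rewrite -cmod_gt0 cmod_real normr_gt0 gt_eqF.
have gP : pick_class g.
  move: gE; have := fB ord0; case: (w ord0) => [a|] f0 gE.
    exact: pick_value_reduction fP v1_gt0 f0 gE.
  exact: pick_pole_reduction fP v1_gt0 f0 gE.
have gB j : match reduced_value x w v j with
    | Some c => boundary_value g (reduced_node x j) c%:C (reduced_slope x w v j)%:C
    | None => boundary_pole g (reduced_node x j) 1%N (- (reduced_slope x w v j)^-1)%:C
    end /\ exists F, meromorphic_extension g (reduced_node x j) F.
  move: gE; have := fB ord0; have := fB (lift ord0 j); have := v'_gt0 j.
  rewrite /reduced_slope /reduced_value /reduced_node.
  have xj := reduced_node_neq j.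
  case: (w ord0) => [a|]; case: (w (lift ord0 j)) => [b|] vj fj f0 gE.
  (* For w_j = w_1 the simple pole of g requires v_j different from 0, which the validity of the
     reduced data provides. *)
  - case: eqVneq vj => [ba /(_ erefl) vj0|ba _].
      rewrite ba in fj; rewrite rmorphN fmorphV.
      apply: (reduction_value_pole vC xj gE) fj.
      by rewrite -cmod_gt0 cmod_real normr_gt0 gt_eqF.
    have baC : (b%:C : C) != a%:C by apply: contraNneq ba => /complexI ->.
    have := reduction_value_regular vC xj gE baC fj.
    by rewrite !(rmorphD, rmorphB, rmorphN, fmorphV, rmorphM, rmorphXn).
  - have := reduction_pole_value vC xj gE fj.
    by rewrite !(rmorphD, rmorphB, rmorphN, fmorphV, rmorphM, rmorphXn) /= invrN opprK invrK.
  - have := pole_reduction_value vC xj gE fj.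
    by rewrite !(rmorphD, rmorphB, rmorphN, fmorphV, rmorphM, rmorphXn).
  exact: pole_reduction_pole vC xj gE _ fj.
by split=> // j; have [] := gB j.
Qed.

End Problem.

Theorem theorem5p3 (R : realType) (n : nat) (n_gt0 : (0 < n)%N)
    (x : 'I_n.+1 -> R) (w : 'I_n.+1 -> option R) (v : 'I_n.+1 -> R)
    (data : problem_data x w v) (v1_gt0 : 0 < v ord0)
    (f : R[i]^o -> R[i]^o) (f_sol : is_solution x w v f) :
  let x' := reduced_node x in
  let w' := reduced_value x w v in
  let v' := reduced_slope x w v in
  let L := diag_mx (reduction_scaling w) in
  [/\ problem_data x' w' v',
      exists g, is_reduction f (x ord0) g,
      forall g, is_reduction f (x ord0) g -> is_solution x' w' v' g &
      L *m pick_matrix x' w' v' *m L = schur (pick_matrix x w v)].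
Proof.
split.
- exact: reduced_problem_data f_sol.
- exact: reduction_exists f_sol.
- by move=> g; exact: reduction_is_solution.
- exact: reduced_pick_matrix.
Qed.
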